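(* Let $d$ be a prime and let $T:\mathcal{B}(\mathbb{C}^d)\to\mathcal{B}(\mathbb{C}^d)$ be a channel. Suppose that for some $0<\varepsilon<1/2$, $$\|\mathrm{id}-T\|_{cb}<2^{-H_2(\varepsilon)/\varepsilon}.$$ Then $$Q(T)\ge(1-4\varepsilon)\log_2 d-H_2(2\varepsilon),$$ where $H_2(r)=-r\log_2r-(1-r)\log_2(1-r)$.
   Context: A channel from input space $\mathcal{H}_1$ to output space $\mathcal{H}_2$ (finite dimensional) is a completely positive unital linear map $T:\mathcal{B}(\mathcal{H}_2)\to\mathcal{B}(\mathcal{H}_1)$. The cb-norm of a linear map $S:\mathcal{B}(\mathcal{K}_2)\to\mathcal{B}(\mathcal{K}_1)$ is $\|S\|_{cb}=\sup\{\|(S\otimes\mathrm{id}_{\mathcal{B}(\mathbb{C}^k)})(A)\|:k\in\mathbb{N},\ A\in\mathcal{B}(\mathcal{K}_2\otimes\mathbb{C}^k),\ \|A\|\le1\}$. For a positive integer $M$, $\Delta(T,M)=\inf_{E,D}\|ETD-\mathrm{id}_{\mathcal{B}(\mathcal{H}_0)}\|_{cb}$, with $\dim\mathcal{H}_0=M$ and the infimum over all channels $D:\mathcal{B}(\mathcal{H}_0)\to\mathcal{B}(\mathcal{H}_2)$ and $E:\mathcal{B}(\mathcal{H}_1)\to\mathcal{B}(\mathcal{H}_0)$. A number $c\ge0$ is an achievable rate if $\lim_{n\to\infty}\Delta(T^{\otimes n},\lfloor2^{cn}\rfloor)=0$, and the quantum capacity $Q(T)$ is the supremum of all achievable rates ($Q(T)=\infty$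 if every $c$ is achievable). *)

(* Defs.v *)
From HB Require Import structures.
From mathcomp Require Import all_boot all_order all_algebra.
From mathcomp Require Import all_classical all_reals all_analysis.
From mathcomp Require Import complex mxtens.
Set Implicit Arguments. Unset Strict Implicit. Unset Printing Implicit Defensive.
Import Order.TTheory GRing.Theory Num.Theory.
Local Open Scope ring_scope.
Local Open Scope classical_set_scope.

Section QC.
Variable R : realType.
Local Notation C := (R[i]).

Definition vnorm n (v : 'cV[C]_n) : R :=
  Num.sqrt (\sum_(i < n) (complex.Re (v i 0) ^+ 2 + complex.Im (v i 0) ^+ 2)).

Definition opnorm m n (A : 'M[C]_(m, n)) : \bar R :=
  ereal_sup [set (vnorm (A *m v))%:E | v in [set v : 'cV[C]_n | vnorm v <= 1]].

(* positive semidefinite: <v, A v> >= 0 for all v (order of the num. closed field C) *)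
Definition psd n (A : 'M[C]_n) : Prop :=
  forall v : 'cV[C]_n, 0 <= ((map_mx (@conjc R) v)^T *m A *m v) 0 0.

(* S (x) id_{B(C^k)}, where B(K (x) C^k) = 'M_(n * k) via mxtens_index *)
Definition amplL n2 n1 (S : 'M[C]_n2 -> 'M[C]_n1) k (A : 'M[C]_(n2 * k))
  : 'M[C]_(n1 * k) :=
  \matrix_(i, j)
    S (\matrix_(a, b) A (mxtens_index (a, (mxtens_unindex i).2))
                        (mxtens_index (b, (mxtens_unindex j).2)))
      (mxtens_unindex i).1 (mxtens_unindex j).1.

Definition amplR k n2 n1 (S : 'M[C]_n2 -> 'M[C]_n1) (A : 'M[C]_(k * n2))
  : 'M[C]_(k * n1) :=
  \matrix_(i, j)
    S (\matrix_(a, b) A (mxtens_index ((mxtens_unindex i).1, a))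
                        (mxtens_index ((mxtens_unindex j).1, b)))
      (mxtens_unindex i).2 (mxtens_unindex j).2.

Definition tensmap a2 a1 b2 b1 (S1 : 'M[C]_a2 -> 'M[C]_a1)
  (S2 : 'M[C]_b2 -> 'M[C]_b1) : 'M[C]_(a2 * b2) -> 'M[C]_(a1 * b1) :=
  fun A => amplL S1 (amplR S2 A).

Definition cbnorm n2 n1 (S : 'M[C]_n2 -> 'M[C]_n1) : \bar R :=
  ereal_sup [set x | exists (k : nat) (A : 'M[C]_(n2 * k)),
     (opnorm A <= 1%:E)%E /\ x = opnorm (amplL S A)].

(* channel (Heisenberg picture): completely positive unital linear map *)
Definition channel n2 n1 (T : 'M[C]_n2 -> 'M[C]_n1) : Prop :=
  linear T /\ T 1%:M = 1%:M /\
  forall k (A : 'M[C]_(n2 * k)), psd A -> psd (amplL T A).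

Fixpoint pw (d n : nat) : nat := if n is n'.+1 then (d * pw d n')%N else 1%N.

Fixpoint tpow d (T : 'M[C]_d -> 'M[C]_d) (n : nat)
  : 'M[C]_(pw d n) -> 'M[C]_(pw d n) :=
  match n as n0 return 'M[C]_(pw d n0) -> 'M[C]_(pw d n0) with
  | 0 => id
  | n'.+1 => tensmap T (@tpow d T n')
  end.

Definition Delta n2 n1 (T : 'M[C]_n2 -> 'M[C]_n1) (M : nat) : \bar R :=
  ereal_inf [set cbnorm (fun X => E (T (D X)) - X) |
     E in [set E : 'M[C]_n1 -> 'M[C]_M | channel E] &
     D in [set D : 'M[C]_M -> 'M[C]_n2 | channel D]].

Definition achievable d (T : 'M[C]_d -> 'M[C]_d) (c : R) : Prop :=
  0 <= c /\
  (fun n : nat => Delta (@tpow d T n) (Num.truncn (2 `^ (c * n%:R)))) @ \oo --> 0%E.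

Definition Qcap d (T : 'M[C]_d -> 'M[C]_d) : \bar R :=
  ereal_sup [set c%:E | c in [set c : R | achievable T c]].

Definition log2 (x : R) : R := ln x / ln 2.

Definition H2 (r : R) : R := - r * log2 r - (1 - r) * log2 (1 - r).

End QC.

(* Main.v *)
Require Import Defs.
From HB Require Import structures.
From mathcomp Require Import all_boot all_order all_algebra.
From mathcomp Require Import all_classical all_reals all_analysis.
From mathcomp Require Import complex mxtens.
From mathcomp Require Import ring lra.
Import Order.TTheory GRing.Theory Num.Theory.
Local Open Scope ring_scope.
Set Implicit Arguments. Unset Strict Implicit. Unset Printing Implicit Defensive.

(** Quantum Gilbert-Varshamov bound with random graph codes. Write [L = T - id]
and expand the n-th tensor power of [T = id + L] according to the number [j] of
factors [L]. A term with [j] factors has the form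
[A |-> sum K^* A K'] with [K], [K'] acting on at most [j] sites, and for [j > 0]
it kills the identity; a code correcting [f] errors therefore annihilates all the
terms with [0 < j <= f] exactly, and leaves [id] for [j = 0]. The remaining terms
have cb-norm at most [sum_(j > f) C(n, j) delta^j], where
[delta = ||T - id||_cb]. With [f = floor(eps n)] and
[delta0 = 2^(- H2 eps / eps) = eps (1 - eps)^((1 - eps) / eps)] one has
[delta0^j <= eps^j (1 - eps)^(n - j)] for [j >= eps n], so the tail is at most
[(delta / delta0)^(f + 1)], which tends to [0].

Codes come from a quadratic form [Q z = z G z^T] over [F_d]: the code words are
[sum_y chi (Q (x, y)) |y>]. A Pauli operator with shift [a] and phase [b] has
nonzero matrix element between the words [x] and [x'] only if [b] is the output
part of [(x' - x, a) (G + G^T)]. For [(x' - x, a) <> 0] a random [G] satisfies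
this with probability at most [d^(1 - n)], so a good [G] exists as soon as [d^k]
times the number of Pauli operators of weight at most [2 f], itself at most
[d^(4 eps n) 2^(n H2(2 eps))], is smaller than [d^(n - 1)]. *)

(** * Completely bounded maps *)

Lemma mxtens_unindexE m n (x : 'I_(m * n)) :
  mxtens_index ((mxtens_unindex x).1, (mxtens_unindex x).2) = x.
Proof. by rewrite -surjective_pairing mxtens_unindexK. Qed.


Section Bounds.
Variable R : realType.
Local Notation C := (R[i]).

Definition nsq (z : C) : R := complex.Re z ^+ 2 + complex.Im z ^+ 2.

Lemma nsq_ge0 z : 0 <= nsq z.
Proof. by rewrite addr_ge0 // sqr_ge0. Qed.

Lemma nsq0 : nsq 0 = 0.
Proof. by rewrite /nsq /= expr0n addr0. Qed.

Lemma nsq_eq0 z : nsq z = 0 -> z = 0.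
Proof.
case: z => a b; rewrite /nsq /= => /eqP.
by rewrite paddr_eq0 ?sqr_ge0 // !sqrf_eq0 => /andP[/eqP-> /eqP->].
Qed.

Lemma nsqM z w : nsq (z * w) = nsq z * nsq w.
Proof. by case: z => a b; case: w => a' b'; rewrite /nsq /=; ring. Qed.

Lemma nsqN z : nsq (- z) = nsq z.
Proof. by case: z => a b; rewrite /nsq /=; ring. Qed.

Lemma nsqC z : (nsq z)%:C%C = z * conjc z.
Proof. by rewrite /nsq add_Re2_Im2 sqr_normc. Qed.

Lemma nsqR (r : R) : nsq r%:C%C = r ^+ 2.
Proof. by rewrite /nsq /=; ring. Qed.

(** Young's inequality with weight [t]: multiplied by [t], the right side minus the left side is the
    squared modulus of [t z - w]. *)
Lemma nsqD_le (t : R) z w : 0 < t ->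
  nsq (z + w) <= (1 + t) * nsq z + (1 + t^-1) * nsq w.
Proof.
move=> t0; rewrite -(ler_pM2l t0); case: z => a b; case: w => a' b'.
rewrite /nsq /=; have -> : t * ((1 + t) * (a ^+ 2 + b ^+ 2) +
  (1 + t^-1) * (a' ^+ 2 + b' ^+ 2)) = t * (1 + t) * (a ^+ 2 + b ^+ 2) +
  (t + 1) * (a' ^+ 2 + b' ^+ 2) by field; rewrite gt_eqF.
have := sqr_ge0 (t * a - a'); have := sqr_ge0 (t * b - b'); nra.
Qed.

Section N2.
Variable I : finType.
Implicit Types v w : I -> C.

Definition N2 v : R := \sum_i nsq (v i).

Lemma N2_ge0 v : 0 <= N2 v.
Proof. by apply: sumr_ge0 => i _; exact: nsq_ge0. Qed.

Lemma eq_N2 v w : v =1 w -> N2 v = N2 w.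
Proof. by move=> vw; apply: eq_bigr => i _; rewrite vw. Qed.

Lemma N2_eq0 v i : N2 v = 0 -> v i = 0.
Proof.
move/eqP; rewrite psumr_eq0 => [/allP/(_ i)|j _]; last exact: nsq_ge0.
by rewrite mem_index_enum => /(_ isT)/eqP/nsq_eq0.
Qed.

Lemma N2D_le (t : R) v w : 0 < t ->
  N2 (fun i => v i + w i) <= (1 + t) * N2 v + (1 + t^-1) * N2 w.
Proof.
move=> t0; rewrite /N2 !mulr_sumr -big_split /=.
by apply: ler_sum => i _; exact: nsqD_le.
Qed.

Lemma N2Z c v : N2 (fun i => c * v i) = nsq c * N2 v.
Proof. by rewrite /N2 mulr_sumr; apply: eq_bigr => i _; rewrite nsqM. Qed.

(** The triangle inequality in squared form. The weight [t = s / r] in [N2D_le] turns the two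
    coefficients into [(r + s) / r] and [(r + s) / s]; if [r] or [s] is zero, the corresponding
    vector vanishes. *)
Lemma N2D_bound (r s N : R) v w : 0 <= r -> 0 <= s -> 0 <= N ->
  N2 v <= r ^+ 2 * N -> N2 w <= s ^+ 2 * N ->
  N2 (fun i => v i + w i) <= (r + s) ^+ 2 * N.
Proof.
move=> r0 s0 N0 hv hw.
have z0 u (x : R) : x = 0 -> N2 u <= x ^+ 2 * N -> forall i, u i = 0.
  move=> -> hu i; apply: N2_eq0; apply/eqP.
  by rewrite eq_le N2_ge0 andbT (le_trans hu)// expr0n mul0r.
have [r00|rp] := eqVneq r 0.
  rewrite r00 add0r (_ : N2 _ = N2 w)//; apply: eq_N2 => i.
  by rewrite (z0 _ _ r00 hv) add0r.
have [s00|sp] := eqVneq s 0.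
  rewrite s00 addr0 (_ : N2 _ = N2 v)//; apply: eq_N2 => i.
  by rewrite (z0 _ _ s00 hw) addr0.
have {}rp : 0 < r by rewrite lt_neqAle eq_sym rp.
have {}sp : 0 < s by rewrite lt_neqAle eq_sym sp.
have t0 : 0 < s / r by rewrite divr_gt0.
apply: (le_trans (N2D_le v w t0)).
have -> : (r + s) ^+ 2 * N =
  (1 + s / r) * (r ^+ 2 * N) + (1 + (s / r)^-1) * (s ^+ 2 * N).
  by field; rewrite !gt_eqF.
by rewrite lerD // ler_wpM2l // addr_ge0 // ?invr_ge0 ltW.
Qed.

End N2.

Lemma N2_reindex (I J : finType) (h : I -> J) (v : J -> C) :
  bijective h -> N2 (fun i => v (h i)) = N2 v.
Proof. by move=> bh; rewrite /N2 (reindex h) //; exact: onW_bij. Qed.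

(** Operator norm at most [|r|], in squared form so that no square root or supremum appears, and for
    families over arbitrary finite types so that indices can be regrouped freely. *)
Definition opb (I J : finType) (A : I -> J -> C) (r : R) : Prop :=
  forall v : J -> C, N2 (fun i => \sum_j A i j * v j) <= r ^+ 2 * N2 v.

Lemma eq_opb (I J : finType) (A B : I -> J -> C) r :
  (forall i j, A i j = B i j) -> opb A r -> opb B r.
Proof.
move=> AB hA v; rewrite -(@eq_N2 _ (fun i => \sum_j A i j * v j)) // => i.
by apply: eq_bigr => j _; rewrite AB.
Qed.

Lemma opb0 (I J : finType) : opb (fun (_ : I) (_ : J) => 0) 0.
Proof.
move=> v; rewrite expr0n /= mul0r /N2 big1 // => i _.
by rewrite big1 ?nsq0 // => j _; rewrite mul0r.
Qed.

Lemma opbD (I J : finType) (A B : I -> J -> C) r s : 0 <= r -> 0 <= s ->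
  opb A r -> opb B s -> opb (fun i j => A i j + B i j) (r + s).
Proof.
move=> r0 s0 hA hB v.
have := N2D_bound r0 s0 (N2_ge0 v) (hA v) (hB v).
by congr (_ <= _); apply: eq_N2 => i; rewrite -big_split /=; apply: eq_bigr => j _;
  rewrite mulrDl.
Qed.

Lemma opbN (I J : finType) (A : I -> J -> C) r :
  opb A r -> opb (fun i j => - A i j) r.
Proof.
move=> hA v; have := hA v; congr (_ <= _); apply: eq_bigr => i _.
by rewrite -nsqN -sumrN; congr nsq; apply: eq_bigr => j _; rewrite mulNr.
Qed.

Lemma opb_reindex (I J I' J' : finType) (g : I' -> I) (h : J' -> J)
    (A : I -> J -> C) r : bijective g -> bijective h ->
  opb A r -> opb (fun i j => A (g i) (h j)) r.
Proof.
move=> bg bh hA v; have [h' hK h'K] := bh.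
have := hA (fun j => v (h' j)).
rewrite (N2_reindex v); last by exists h.
rewrite -(N2_reindex (fun i => \sum_j A i j * v (h' j)) bg).
congr (_ <= _); apply: eq_N2 => i.
rewrite (reindex h); last exact: onW_bij.
by apply: eq_bigr => j _; rewrite hK.
Qed.

Definition ampl n2 n1 (S : 'M[C]_n2 -> 'M[C]_n1) (K : finType)
    (A : 'I_n2 * K -> 'I_n2 * K -> C) : 'I_n1 * K -> 'I_n1 * K -> C :=
  fun i j => S (\matrix_(a, b) A (a, i.2) (b, j.2)) i.1 j.1.

(* [cbb S r] is [||S||_cb <= r]; an arbitrary finite type as ancilla makes
   regrouping tensor factors a mere reindexing. *)
Definition cbb n2 n1 (S : 'M[C]_n2 -> 'M[C]_n1) (r : R) : Prop :=
  forall (K : finType) (A : 'I_n2 * K -> 'I_n2 * K -> C) (s : R),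
    0 <= s -> opb A s -> opb (ampl S A) (r * s).

Lemma eq_cbb n2 n1 (S S' : 'M[C]_n2 -> 'M[C]_n1) r :
  S =1 S' -> cbb S r -> cbb S' r.
Proof.
move=> SS' hS K A s s0 hA; apply: eq_opb (hS K A s s0 hA) => i j.
by rewrite /ampl SS'.
Qed.

Lemma cbb_zero n2 n1 : cbb (fun _ : 'M[C]_n2 => (0 : 'M[C]_n1)) 0.
Proof.
move=> K A s s0 hA; rewrite mul0r; apply: eq_opb (@opb0 _ _) => i j.
by rewrite /ampl mxE.
Qed.

Lemma cbbD n2 n1 (S S' : 'M[C]_n2 -> 'M[C]_n1) r r' : 0 <= r -> 0 <= r' ->
  cbb S r -> cbb S' r' -> cbb (fun X => S X + S' X) (r + r').
Proof.
move=> r0 r'0 hS hS' K A s s0 hA; rewrite mulrDl.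
apply: eq_opb (opbD _ _ (hS K A s s0 hA) (hS' K A s s0 hA)); rewrite ?mulr_ge0 //.
by move=> i j; rewrite /ampl mxE.
Qed.

Lemma cbbN n2 n1 (S : 'M[C]_n2 -> 'M[C]_n1) r :
  cbb S r -> cbb (fun X => - S X) r.
Proof.
move=> hS K A s s0 hA; apply: eq_opb (opbN (hS K A s s0 hA)) => i j.
by rewrite /ampl mxE.
Qed.

Lemma cbb_sum n2 n1 (J : Type) (r : seq J) (P : pred J)
    (S : J -> 'M[C]_n2 -> 'M[C]_n1) (b : J -> R) :
  (forall j, P j -> 0 <= b j) -> (forall j, P j -> cbb (S j) (b j)) ->
  cbb (fun X => \sum_(j <- r | P j) S j X) (\sum_(j <- r | P j) b j).
Proof.
move=> b0 hS; elim: r => [|j r IH].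
  by rewrite big_nil; apply: eq_cbb (@cbb_zero _ _) => X; rewrite big_nil.
rewrite big_cons; case: ifP => Pj; last first.
  by apply: eq_cbb IH => X; rewrite big_cons Pj.
apply: (eq_cbb _ (cbbD _ _ (hS j Pj) IH)); last 2 first.
- exact: b0.
- exact: sumr_ge0.
by move=> X; rewrite big_cons Pj.
Qed.

Lemma cbb_comp n3 n2 n1 (S : 'M[C]_n2 -> 'M[C]_n1) (S' : 'M[C]_n3 -> 'M[C]_n2)
  r r' : 0 <= r' -> cbb S r -> cbb S' r' -> cbb (fun X => S (S' X)) (r * r').
Proof.
move=> r'0 hS hS' K A s s0 hA; rewrite -mulrA.
apply: eq_opb (hS K _ _ _ (hS' K A s s0 hA)); last by rewrite mulr_ge0.
move=> i j; rewrite /ampl /=; congr (S _ _ _).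
by apply/matrixP => a b; rewrite mxE.
Qed.

Lemma cbb_id n : cbb (fun X : 'M[C]_n => X) 1.
Proof.
move=> K A s s0 hA; rewrite mul1r; apply: eq_opb hA => -[i k] [j l].
by rewrite /ampl mxE.
Qed.

(** The two factors act one after the other: [S2] with ancilla ['I_a2 * K], then [S1] with ancilla
    ['I_b1 * K]. The maps [g], [g'], [g''] only regroup indices between these stages. *)
Lemma cbb_tensmap a2 a1 b2 b1 (S1 : 'M[C]_a2 -> 'M[C]_a1)
    (S2 : 'M[C]_b2 -> 'M[C]_b1) r1 r2 :
  0 <= r2 -> cbb S1 r1 -> cbb S2 r2 -> cbb (tensmap S1 S2) (r1 * r2).
Proof.
move=> r20 h1 h2 K A s s0 hA; rewrite -mulrA.
pose g (x : 'I_b2 * ('I_a2 * K)) : 'I_(a2 * b2) * K :=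
  (mxtens_index (x.2.1, x.1), x.2.2).
have bg : bijective g.
  exists (fun y => ((mxtens_unindex y.1).2, ((mxtens_unindex y.1).1, y.2))).
    by case=> i [j k]; rewrite /g mxtens_indexK.
  by case=> i k; rewrite /g mxtens_unindexE.
have hB := h2 _ _ _ s0 (opb_reindex bg bg hA).
pose g' (x : 'I_a2 * ('I_b1 * K)) : 'I_b1 * ('I_a2 * K) :=
  (x.2.1, (x.1, x.2.2)).
have bg' : bijective g'.
  by exists (fun y => (y.2.1, (y.1, y.2.2))) => [] [x [y z]].
have hD := h1 _ _ _ (mulr_ge0 r20 s0) (opb_reindex bg' bg' hB).
pose g'' (x : 'I_(a1 * b1) * K) : 'I_a1 * ('I_b1 * K) :=
  ((mxtens_unindex x.1).1, ((mxtens_unindex x.1).2, x.2)).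
have bg'' : bijective g''.
  exists (fun y => (mxtens_index (y.1, y.2.1), y.2.2)).
    by case=> i k; rewrite /g'' mxtens_unindexE.
  by case=> i [j k]; rewrite /g'' mxtens_indexK.
apply: eq_opb (opb_reindex bg'' bg'' hD) => i j.
rewrite /ampl /tensmap /amplL /amplR mxE.
congr (S1 _ _ _); apply/matrixP => a b; rewrite !mxE !mxtens_indexK /=.
by congr (S2 _ _ _); apply/matrixP => u v; rewrite !mxE.
Qed.

Lemma vnormE n (v : 'cV[C]_n) : vnorm v = Num.sqrt (N2 (fun i => v i 0)).
Proof. by []. Qed.

Lemma vnorm_mulmxE m n (A : 'M[C]_(m, n)) v :
  vnorm (A *m v) = Num.sqrt (N2 (fun i => \sum_j A i j * v j 0)).
Proof. by rewrite vnormE; congr Num.sqrt; apply: eq_N2 => i; rewrite mxE. Qed.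

Lemma opnorm_le_opb m n (A : 'M[C]_(m, n)) r : 0 <= r ->
  (opnorm A <= r%:E)%E -> opb A r.
Proof.
move=> r0 hA v; have [v0|vn0] := eqVneq (N2 v) 0.
  rewrite v0 mulr0 (_ : N2 _ = 0) //; apply: big1 => i _.
  by rewrite big1 ?nsq0 // => j _; rewrite (N2_eq0 j v0) mulr0.
have vp : 0 < N2 v by rewrite lt_neqAle eq_sym vn0 N2_ge0.
set s := Num.sqrt (N2 v); have sp : 0 < s by rewrite sqrtr_gt0.
pose w : 'cV[C]_n := \col_j ((s^-1)%:C%C * v j).
have nw : vnorm w <= 1.
  rewrite vnormE (@eq_N2 _ _ (fun j => (s^-1)%:C%C * v j)) => [|j]; last by rewrite mxE.
  rewrite N2Z nsqR exprVn sqr_sqrtr ?N2_ge0 // mulVf // sqrtr1 //.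
have : ((vnorm (A *m w))%:E <= r%:E)%E.
  by apply: le_trans hA; apply: ereal_sup_ubound; exists w.
rewrite lee_fin vnorm_mulmxE.
rewrite (@eq_N2 _ _ (fun i => (s^-1)%:C%C * \sum_j A i j * v j)) => [|i]; last first.
  by rewrite mulr_sumr; apply: eq_bigr => j _; rewrite mxE mulrCA.
rewrite N2Z nsqR sqrtrM ?sqr_ge0 // sqrtr_sqr ger0_norm ?invr_ge0 ?(ltW sp) //.
rewrite mulrC ler_pdivrMr // => h.
rewrite -[X in X <= _]sqr_sqrtr ?N2_ge0 // -[N2 v]sqr_sqrtr ?N2_ge0 // -exprMn.
by rewrite lerXn2r ?nnegrE ?sqrtr_ge0 ?mulr_ge0.
Qed.

Lemma opb_opnorm_le m n (A : 'M[C]_(m, n)) r : 0 <= r ->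
  opb A r -> (opnorm A <= r%:E)%E.
Proof.
move=> r0 hA; apply: ge_ereal_sup => _ [v /= nv <-]; rewrite lee_fin vnorm_mulmxE.
have h := hA (fun j => v j 0).
rewrite -(ger0_norm r0) -sqrtr_sqr ler_wsqrtr // (le_trans h) //.
rewrite ler_piMr ?sqr_ge0 // -[N2 _]sqr_sqrtr ?N2_ge0 // -vnormE.
by rewrite expr_le1 // vnormE sqrtr_ge0.
Qed.

Lemma mxtens_unindex_bij m n : bijective (@mxtens_unindex m n).
Proof. by exists (@mxtens_index m n); [exact: mxtens_unindexK|exact: mxtens_indexK]. Qed.

Lemma mxtens_index_bij m n : bijective (@mxtens_index m n).
Proof. by exists (@mxtens_unindex m n); [exact: mxtens_indexK|exact: mxtens_unindexK]. Qed.

Lemma cbb_opb_amplL n2 n1 (S : 'M[C]_n2 -> 'M[C]_n1) r k (A : 'M[C]_(n2 * k)) s :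
  0 <= s -> cbb S r -> opb A s -> opb (amplL S A) (r * s).
Proof.
move=> s0 hS hA.
have h := hS _ _ _ s0 (opb_reindex (mxtens_index_bij n2 k) (mxtens_index_bij n2 k) hA).
apply: eq_opb (opb_reindex (mxtens_unindex_bij n1 k) (mxtens_unindex_bij n1 k) h).
by move=> i j; rewrite /ampl /amplL mxE.
Qed.

(** Enumerating the finite ancilla [K] reduces [cbb] to matrix ancillas [C^k] with [k = #|K|]. *)
Lemma cbb_amplL n2 n1 (S : 'M[C]_n2 -> 'M[C]_n1) r :
  (forall k (A : 'M[C]_(n2 * k)) s, 0 <= s -> opb A s -> opb (amplL S A) (r * s)) ->
  cbb S r.
Proof.
move=> hS K A s s0 hA.
pose g (x : 'I_(n2 * #|K|)) : 'I_n2 * K :=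
  ((mxtens_unindex x).1, enum_val (mxtens_unindex x).2).
have bg : bijective g.
  exists (fun y => mxtens_index (y.1, enum_rank y.2)).
    by move=> x; rewrite /g enum_valK mxtens_unindexE.
  by case=> i k; rewrite /g mxtens_indexK /= enum_rankK.
pose B : 'M[C]_(n2 * #|K|) := \matrix_(i, j) A (g i) (g j).
have hB : opb B s.
  by apply: eq_opb (opb_reindex bg bg hA) => i j; rewrite mxE.
pose g' (y : 'I_n1 * K) : 'I_(n1 * #|K|) := mxtens_index (y.1, enum_rank y.2).
have bg' : bijective g'.
  exists (fun x => ((mxtens_unindex x).1, enum_val (mxtens_unindex x).2)).
    by case=> i k; rewrite /g' mxtens_indexK /= enum_rankK.
  by move=> x; rewrite /g' enum_valK mxtens_unindexE.
apply: eq_opb (opb_reindex bg' bg' (hS _ B s s0 hB)) => i j.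
rewrite /amplL /ampl mxE /g' !mxtens_indexK; congr (S _ _ _).
by apply/matrixP => a b; rewrite !mxE /g !mxtens_indexK !enum_rankK.
Qed.

Lemma cbb_cbnorm_le n2 n1 (S : 'M[C]_n2 -> 'M[C]_n1) r : 0 <= r ->
  cbb S r -> (cbnorm S <= r%:E)%E.
Proof.
move=> r0 hS; apply: ge_ereal_sup => _ [k [A [nA ->]]].
apply: opb_opnorm_le => //; rewrite -[r]mulr1.
by apply: cbb_opb_amplL => //; exact: opnorm_le_opb.
Qed.

(** The ancilla [k = 0] with the zero matrix enters the supremum, and its [opnorm] is at least the
    value 0 taken at the zero vector. *)
Lemma cbnorm_ge0 n2 n1 (S : 'M[C]_n2 -> 'M[C]_n1) : (0 <= cbnorm S)%E.
Proof.
apply: (@le_trans _ _ (opnorm (amplL S (0 : 'M[C]_(n2 * 0))))); last first.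
  apply: ereal_sup_ubound; exists 0, 0; split => //.
  apply: opb_opnorm_le => // v; rewrite expr1n mul1r /N2 big1 ?N2_ge0 // => i _.
  by rewrite big1 ?nsq0 // => j _; rewrite mxE mul0r.
have vn0 n : vnorm (0 : 'cV[C]_n) = 0.
  by rewrite vnormE /N2 big1 ?sqrtr0 // => i _; rewrite mxE nsq0.
apply: (@le_trans _ _ (vnorm (amplL S (0 : 'M[C]_(n2 * 0)) *m 0))%:E).
  by rewrite mulmx0 vn0.
by apply: ereal_sup_ubound; exists 0 => //=; rewrite vn0.
Qed.

Lemma linear_scalemx n2 n1 (S : 'M[C]_n2 -> 'M[C]_n1) : linear S ->
  forall c X, S (c *: X) = c *: S X.
Proof.
move=> lS c X; have S0 : S 0 = 0.
  by have := lS (-1) 0 0; rewrite scaler0 addr0 scaleN1r addNr.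
by have := lS c X 0; rewrite S0 !addr0.
Qed.

(** The supremum only tests matrices of norm at most 1; linearity allows rescaling by [1 / s], while
    [s = 0] forces [A = 0]. *)
Lemma cbnorm_le_cbb n2 n1 (S : 'M[C]_n2 -> 'M[C]_n1) r : linear S -> 0 <= r ->
  (cbnorm S <= r%:E)%E -> cbb S r.
Proof.
move=> lS r0 hS; apply: cbb_amplL => k A s s0 hA.
have Sz := linear_scalemx lS.
have [s00|sn0] := eqVneq s 0.
  have A0 : A = 0.
    apply/matrixP => i j; rewrite mxE.
    have := hA (fun j' => (j' == j)%:R); rewrite s00 expr0n /= mul0r => h.
    have /(N2_eq0 i) : N2 (fun i => \sum_j' A i j' * (j' == j)%:R) = 0.
      by apply/eqP; rewrite eq_le h N2_ge0.
    rewrite (bigD1 j) //= eqxx mulr1 big1 ?addr0 // => j' /negbTE ->.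
    by rewrite mulr0.
  rewrite s00 mulr0; apply: eq_opb (@opb0 _ _) => i j; rewrite /amplL mxE A0.
  rewrite (_ : \matrix_(a, b) _ = 0 *: 0); first by rewrite Sz scale0r mxE.
  by rewrite scale0r; apply/matrixP => a b; rewrite !mxE.
have sp : 0 < s by rewrite lt_neqAle eq_sym sn0.
have scale_opb m n (B : 'M[C]_(m, n)) (t u : R) : opb B u -> opb (t%:C%C *: B) (t * u).
  move=> hB v; have := hB v => h.
  rewrite (@eq_N2 _ _ (fun i => t%:C%C * \sum_j B i j * v j)) => [|i]; last first.
    by rewrite mulr_sumr; apply: eq_bigr => j _; rewrite mxE mulrA.
  by rewrite N2Z nsqR exprMn -[_ * _ * N2 v]mulrA ler_wpM2l ?sqr_ge0.
have nA' : (opnorm ((s^-1)%:C%C *: A) <= 1%:E)%E.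
  apply: opb_opnorm_le => //; rewrite -(mulVf sn0); exact: scale_opb.
have : (opnorm (amplL S ((s^-1)%:C%C *: A)) <= r%:E)%E.
  by apply: le_trans hS; apply: ereal_sup_ubound; exists k, ((s^-1)%:C%C *: A).
move=> /(opnorm_le_opb r0)/(@scale_opb _ _ _ s); rewrite mulrC; apply: eq_opb => i j.
rewrite /amplL !mxE (_ : \matrix_(a, b) _ = (s^-1)%:C%C *: \matrix_(a, b)
  A (mxtens_index (a, (mxtens_unindex i).2)) (mxtens_index (b, (mxtens_unindex j).2))).
  by rewrite Sz mxE mulrA -rmorphM /= mulfV // mul1r.
by apply/matrixP => a b; rewrite !mxE.
Qed.

End Bounds.

(** * Kraus maps and sums of sandwiches *)

Section Kraus.
Variable R : realType.
Local Notation C := (R[i]).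

Definition adj m n (A : 'M[C]_(m, n)) : 'M[C]_(n, m) := (map_mx (@conjc R) A)^T.

Lemma adjE m n (A : 'M[C]_(m, n)) i j : adj A i j = conjc (A j i).
Proof. by rewrite !mxE. Qed.

Lemma adjK m n (A : 'M[C]_(m, n)) : adj (adj A) = A.
Proof. by apply/matrixP => i j; rewrite !adjE conjcK. Qed.

Lemma adjM m n p (A : 'M[C]_(m, n)) (B : 'M[C]_(n, p)) :
  adj (A *m B) = adj B *m adj A.
Proof. by rewrite /adj map_mxM trmx_mul. Qed.

Lemma adjD m n (A B : 'M[C]_(m, n)) : adj (A + B) = adj A + adj B.
Proof. by rewrite /adj map_mxD linearD. Qed.

Lemma adjB m n (A B : 'M[C]_(m, n)) : adj (A - B) = adj A - adj B.
Proof. by rewrite /adj map_mxB linearB. Qed.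

Lemma adj0 m n : adj (0 : 'M[C]_(m, n)) = 0.
Proof. by rewrite /adj map_mx0 trmx0. Qed.

Lemma adj_scale m n c (A : 'M[C]_(m, n)) : adj (c *: A) = conjc c *: adj A.
Proof. by rewrite /adj map_mxZ linearZ. Qed.

Lemma adj_1mx n : adj (1%:M : 'M[C]_n) = 1%:M.
Proof. by rewrite /adj map_mx1 trmx1. Qed.

Lemma adj_sum m n (J : finType) (P : pred J) (A : J -> 'M[C]_(m, n)) :
  adj (\sum_(j | P j) A j) = \sum_(j | P j) adj (A j).
Proof. by apply: big_morph; [exact: adjD | exact: adj0]. Qed.

Lemma adj_delta m n (i : 'I_m) (j : 'I_n) :
  adj (delta_mx i j : 'M[C]_(m, n)) = delta_mx j i.
Proof. by rewrite /adj map_delta_mx trmx_delta. Qed.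

Lemma adj_tens m n p q (A : 'M[C]_(m, n)) (B : 'M[C]_(p, q)) :
  adj (A *t B) = adj A *t adj B.
Proof. by rewrite /adj map_mxT trmx_tens. Qed.

Lemma tensmx11 m n : (1%:M : 'M[C]_m) *t (1%:M : 'M[C]_n) = 1%:M.
Proof.
apply/matrixP => i j; case: (mxtens_indexP i) => i1 i2.
case: (mxtens_indexP j) => j1 j2; rewrite tensmxE !mxE.
rewrite (can_eq (@mxtens_indexK m n)) xpair_eqE.
by case: eqP => _; case: eqP => _ /=; rewrite ?mulr1 ?mulr0.
Qed.

Lemma sum_mxtens (V : nmodType) m n (G : 'I_(m * n) -> V) :
  \sum_p G p = \sum_i \sum_j G (mxtens_index (i, j)).
Proof.
rewrite pair_big /= (reindex (@mxtens_index m n)) /=.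
  by apply: eq_bigr => -[i j].
exact/onW_bij/mxtens_index_bij.
Qed.

Lemma mxtens_matrixP (V : Type) m1 m2 n1 n2 (A B : 'M[V]_(m1 * m2, n1 * n2)) :
  (forall i1 i2 j1 j2, A (mxtens_index (i1, i2)) (mxtens_index (j1, j2)) =
                       B (mxtens_index (i1, i2)) (mxtens_index (j1, j2))) ->
  A = B.
Proof.
move=> AB; apply/matrixP => i j; case: (mxtens_indexP i) => i1 i2.
by case: (mxtens_indexP j) => j1 j2.
Qed.

Lemma mul_tens1E m n k p (K : 'M[C]_(m, n)) (A : 'M[C]_(n * k, p)) i1 i2 j :
  ((K *t 1%:M) *m A) (mxtens_index (i1, i2)) j =
  \sum_a K i1 a * A (mxtens_index (a, i2)) j.
Proof.
rewrite mxE sum_mxtens; apply: eq_bigr => a _; rewrite (bigD1 i2) //= tensmxE.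
rewrite mxE eqxx mulr1 big1 ?addr0 // => j2 /negbTE j2i.
by rewrite tensmxE mxE eq_sym j2i mulr0 mul0r.
Qed.

Lemma mul_1tensE m n k p (K : 'M[C]_(m, n)) (A : 'M[C]_(k * n, p)) i1 i2 j :
  ((1%:M *t K) *m A) (mxtens_index (i1, i2)) j =
  \sum_a K i2 a * A (mxtens_index (i1, a)) j.
Proof.
rewrite mxE sum_mxtens (bigD1 i1) //= [X in _ + X]big1 ?addr0 => [|a /negbTE ai].
  by apply: eq_bigr => a _; rewrite tensmxE mxE eqxx mul1r.
by apply: big1 => b _; rewrite tensmxE mxE eq_sym ai !mul0r.
Qed.

Lemma tens1_mulE m n k p (K : 'M[C]_(n, m)) (A : 'M[C]_(p, n * k)) i j1 j2 :
  (A *m (K *t 1%:M)) i (mxtens_index (j1, j2)) =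
  \sum_b A i (mxtens_index (b, j2)) * K b j1.
Proof.
rewrite mxE sum_mxtens; apply: eq_bigr => a _; rewrite (bigD1 j2) //= tensmxE.
rewrite mxE eqxx mulr1 big1 ?addr0 // => i2 /negbTE j2i.
by rewrite tensmxE mxE j2i !mulr0.
Qed.

Lemma tens_1mulE m n k p (K : 'M[C]_(n, m)) (A : 'M[C]_(p, k * n)) i j1 j2 :
  (A *m (1%:M *t K)) i (mxtens_index (j1, j2)) =
  \sum_b A i (mxtens_index (j1, b)) * K b j2.
Proof.
rewrite mxE sum_mxtens (bigD1 j1) //= [X in _ + X]big1 ?addr0 => [|a /negbTE aj].
  by apply: eq_bigr => a _; rewrite tensmxE mxE eqxx mul1r.
by apply: big1 => b _; rewrite tensmxE mxE aj mul0r mulr0.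
Qed.

Lemma amplLE n2 n1 (S : 'M[C]_n2 -> 'M[C]_n1) k (A : 'M[C]_(n2 * k)) i1 i2 j1 j2 :
  amplL S A (mxtens_index (i1, i2)) (mxtens_index (j1, j2)) =
  S (\matrix_(a, b) A (mxtens_index (a, i2)) (mxtens_index (b, j2))) i1 j1.
Proof. by rewrite /amplL mxE !mxtens_indexK. Qed.

Lemma amplRE k n2 n1 (S : 'M[C]_n2 -> 'M[C]_n1) (A : 'M[C]_(k * n2)) i1 i2 j1 j2 :
  amplR S A (mxtens_index (i1, i2)) (mxtens_index (j1, j2)) =
  S (\matrix_(a, b) A (mxtens_index (i1, a)) (mxtens_index (j1, b))) i2 j2.
Proof. by rewrite /amplR mxE !mxtens_indexK. Qed.

Lemma amplL_mul n2 n1 (K : 'M[C]_(n1, n2)) (K' : 'M[C]_(n2, n1)) k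
    (A : 'M[C]_(n2 * k)) :
  amplL (fun X => K *m X *m K') A = (K *t 1%:M) *m A *m (K' *t 1%:M).
Proof.
apply: mxtens_matrixP => i1 i2 j1 j2; rewrite amplLE tens1_mulE mxE.
apply: eq_bigr => b _; rewrite mul_tens1E mxE; congr (_ * _).
by apply: eq_bigr => a _; rewrite mxE.
Qed.

Lemma amplR_mul k n2 n1 (K : 'M[C]_(n1, n2)) (K' : 'M[C]_(n2, n1))
    (A : 'M[C]_(k * n2)) :
  amplR (fun X => K *m X *m K') A = (1%:M *t K) *m A *m (1%:M *t K').
Proof.
apply: mxtens_matrixP => i1 i2 j1 j2; rewrite amplRE tens_1mulE mxE.
apply: eq_bigr => b _; rewrite mul_1tensE mxE; congr (_ * _).
by apply: eq_bigr => a _; rewrite mxE.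
Qed.

Lemma tensmap_mul a2 a1 b2 b1 (K : 'M[C]_(a1, a2)) (K' : 'M[C]_(a2, a1))
    (L : 'M[C]_(b1, b2)) (L' : 'M[C]_(b2, b1)) A :
  tensmap (fun X => K *m X *m K') (fun X => L *m X *m L') A =
  (K *t L) *m A *m (K' *t L').
Proof.
rewrite /tensmap amplL_mul amplR_mul !mulmxA tensmx_mul mulmx1 mul1mx -!mulmxA.
by rewrite tensmx_mul mul1mx mulmx1.
Qed.

Lemma eq_amplL n2 n1 (S S' : 'M[C]_n2 -> 'M[C]_n1) k (A : 'M[C]_(n2 * k)) :
  S =1 S' -> amplL S A = amplL S' A.
Proof. by move=> e; apply/matrixP => i j; rewrite !mxE e. Qed.

Lemma eq_amplR k n2 n1 (S S' : 'M[C]_n2 -> 'M[C]_n1) (A : 'M[C]_(k * n2)) :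
  S =1 S' -> amplR S A = amplR S' A.
Proof. by move=> e; apply/matrixP => i j; rewrite !mxE e. Qed.

Lemma eq_tensmap a2 a1 b2 b1 (S1 S1' : 'M[C]_a2 -> 'M[C]_a1)
    (S2 S2' : 'M[C]_b2 -> 'M[C]_b1) A :
  S1 =1 S1' -> S2 =1 S2' -> tensmap S1 S2 A = tensmap S1' S2' A.
Proof. by move=> e1 e2; rewrite /tensmap (eq_amplL _ e1) (eq_amplR _ e2). Qed.

Lemma amplL_sum n2 n1 (J : finType) (S : J -> 'M[C]_n2 -> 'M[C]_n1) k
    (A : 'M[C]_(n2 * k)) :
  amplL (fun X => \sum_j S j X) A = \sum_j amplL (S j) A.
Proof.
apply/matrixP => i j; rewrite /amplL !mxE !summxE.
by apply: eq_bigr => l _; rewrite mxE.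
Qed.

Section KrausMap.
Variables (n2 n1 : nat) (J : finType) (K : J -> 'M[C]_(n1, n2)).

Definition kraus (X : 'M[C]_n2) : 'M[C]_n1 := \sum_j K j *m X *m adj (K j).

Lemma kraus_linear : linear kraus.
Proof.
move=> c X Y; rewrite /kraus scaler_sumr -big_split /=; apply: eq_bigr => j _.
by rewrite mulmxDr mulmxDl -scalemxAr -scalemxAl.
Qed.

Lemma amplL_kraus k (A : 'M[C]_(n2 * k)) :
  amplL kraus A = \sum_j (K j *t 1%:M) *m A *m adj (K j *t 1%:M).
Proof.
rewrite /kraus amplL_sum; apply: eq_bigr => j _.
by rewrite amplL_mul adj_tens adj_1mx.
Qed.

Lemma psd_sum n (I : finType) (A : I -> 'M[C]_n) :
  (forall i, psd (A i)) -> psd (\sum_i A i).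
Proof.
move=> hA v; rewrite mulmx_sumr mulmx_suml summxE.
by apply: sumr_ge0 => i _; exact: hA.
Qed.

Lemma psd_conj m n (B : 'M[C]_(m, n)) (A : 'M[C]_n) :
  psd A -> psd (B *m A *m adj B).
Proof.
move=> hA v; have := hA (adj B *m v); rewrite -/(adj _) -/(adj v) adjM adjK.
by rewrite !mulmxA.
Qed.

Hypothesis K1 : \sum_j K j *m adj (K j) = 1%:M.

Lemma kraus_channel : channel kraus.
Proof.
split; first exact: kraus_linear; split.
  by rewrite -K1 /kraus; apply: eq_bigr => j _; rewrite mulmx1.
move=> k A hA; rewrite amplL_kraus; apply: psd_sum => j; exact: psd_conj.
Qed.

Lemma N2_adj n (v : 'cV[C]_n) : (N2 (fun i => v i 0))%:C%C = (adj v *m v) 0 0.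
Proof.
rewrite mxE /N2 raddf_sum; apply: eq_bigr => i _.
by rewrite adjE /= nsqC mulrC.
Qed.

(** The row of all [B j] is a co-isometry, hence a contraction: the slack in the inequality is
    exactly the sum of the squared norms of [w j - adj (B j) s]. *)
Lemma coisometry_contraction m n (B : J -> 'M[C]_(m, n)) (w : J -> 'cV[C]_n) :
  \sum_j B j *m adj (B j) = 1%:M ->
  N2 (fun i => (\sum_j B j *m w j) i 0) <= \sum_j N2 (fun i => w j i 0).
Proof.
move=> B1; set s := \sum_j _.
suff key : \sum_j N2 (fun i => (w j - adj (B j) *m s) i 0) =
    \sum_j N2 (fun i => w j i 0) - N2 (fun i => s i 0).
  by rewrite -subr_ge0 -key; apply: sumr_ge0 => j _; exact: N2_ge0.
apply: complexI; rewrite rmorphB /= N2_adj !rmorph_sum /=.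
have Nadj p (f : J -> 'cV[C]_p) :
    \sum_j (N2 (fun i => f j i 0))%:C%C = (\sum_j adj (f j) *m f j) 0 0.
  by rewrite summxE; apply: eq_bigr => j _; rewrite N2_adj.
rewrite !Nadj.
have -> : \sum_i adj (w i - adj (B i) *m s) *m (w i - adj (B i) *m s) =
   \sum_i adj (w i) *m w i - adj s *m s.
  have -> : \sum_i adj (w i - adj (B i) *m s) *m (w i - adj (B i) *m s) =
    \sum_i adj (w i) *m w i - \sum_i adj (w i) *m adj (B i) *m s
    - \sum_i adj s *m B i *m w i + \sum_i adj s *m (B i *m adj (B i)) *m s.
    rewrite -!sumrB -big_split /=; apply: eq_bigr => j _.
    rewrite adjB adjM adjK mulmxBl !mulmxBr !mulmxA opprB.
    by rewrite addrA addrAC.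
  rewrite -2!mulmx_suml -mulmx_sumr B1 mulmx1.
  have -> : \sum_i adj s *m B i *m w i = adj s *m s.
    by rewrite {3}/s mulmx_sumr; apply: eq_bigr => j _; rewrite mulmxA.
  rewrite (_ : \sum_i adj (w i) *m adj (B i) = adj s) ?subrK //.
  by rewrite /s adj_sum; apply: eq_bigr => j _; rewrite adjM.
by rewrite mxE [X in _ + X]mxE.
Qed.

(** The amplified map is [A] applied blockwise between the row of the [B j] and its adjoint. The
    adjoint column preserves the norm of [u], the blocks contribute [s], and the row is a
    contraction. *)
Lemma kraus_cbb : cbb kraus 1.
Proof.
apply: cbb_amplL => k A s s0 hA v; rewrite mul1r amplL_kraus.
pose B j := K j *t (1%:M : 'M[C]_k).
have B1 : \sum_j B j *m adj (B j) = 1%:M.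
  rewrite -tensmx11 -K1; apply: mxtens_matrixP => i1 i2 j1 j2.
  rewrite tensmxE !summxE mulr_suml; apply: eq_bigr => j _.
  by rewrite /B adj_tens adj_1mx tensmx_mul mulmx1 tensmxE.
pose u : 'cV[C]_(n1 * k) := \col_i v i.
have Av m (M : 'M[C]_(m, n1 * k)) i : \sum_j M i j * v j = (M *m u) i 0.
  by rewrite mxE; apply: eq_bigr => j _; rewrite mxE.
rewrite (@eq_N2 _ _ _ (fun i => (\sum_j B j *m (A *m (adj (B j) *m u))) i 0)); last first.
  move=> i; rewrite Av mulmx_suml; congr (fun_of_matrix _ i 0); apply: eq_bigr => j _.
  by rewrite !mulmxA.
apply: (le_trans (coisometry_contraction _ B1)).
apply: (@le_trans _ _ (\sum_j s ^+ 2 * N2 (fun i => (adj (B j) *m u) i 0))).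
  apply: ler_sum => j _; have := hA (fun i => (adj (B j) *m u) i 0).
  by congr (_ <= _); apply: eq_N2 => i; rewrite mxE.
rewrite -mulr_sumr ler_wpM2l ?sqr_ge0 // -lecR raddf_sum /=.
under eq_bigr do rewrite N2_adj adjM adjK -mulmxA [B _ *m _]mulmxA.
rewrite -summxE -mulmx_sumr -mulmx_suml B1 mul1mx -N2_adj lecR.
by rewrite (@eq_N2 _ _ _ v) // => i; rewrite mxE.
Qed.

End KrausMap.

(** Linear combinations of sandwiches [adj K A K'] with both outer operators in [P]. The equations
    are pointwise, so the predicate is stable under [=1]. *)
Inductive kspan n (P : 'M[C]_n -> Prop) : ('M[C]_n -> 'M[C]_n) -> Prop :=
| kspan0 Phi : (forall A, Phi A = 0) -> kspan P Phi
| kspanD c K K' Phi Phi' : P K -> P K' -> kspan P Phi' ->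
    (forall A, Phi A = c *: (adj K *m A *m K') + Phi' A) -> kspan P Phi.

Lemma eq_kspan n (P : 'M[C]_n -> Prop) Phi Psi :
  Phi =1 Psi -> kspan P Phi -> kspan P Psi.
Proof.
move=> e h; case: h e => [Phi' h e|c K K' Phi' Phi'' PK PK' hP h e].
  by apply: kspan0 => A; rewrite -e.
by apply: (kspanD PK PK' hP) => A; rewrite -e.
Qed.

Lemma kspan_add n (P : 'M[C]_n -> Prop) Phi Psi :
  kspan P Phi -> kspan P Psi -> kspan P (fun A => Phi A + Psi A).
Proof.
move=> hP hQ; elim: hP => [Phi' h|c K K' Phi' Phi'' PK PK' hP IH h].
  by apply: eq_kspan hQ => A; rewrite h add0r.
by apply: (kspanD PK PK' IH) => A; rewrite h addrA.
Qed.

Lemma kspan_scale n (P : 'M[C]_n -> Prop) c Phi :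
  kspan P Phi -> kspan P (fun A => c *: Phi A).
Proof.
elim => [Phi' h|c' K K' Phi' Phi'' PK PK' hP IH h].
  by apply: kspan0 => A; rewrite h scaler0.
by apply: (kspanD (c := c * c') PK PK' IH) => A; rewrite h scalerDr scalerA.
Qed.

Lemma kspan_sum n (P : 'M[C]_n -> Prop) (J : finType) (Phi : J -> 'M[C]_n -> 'M[C]_n) :
  (forall j, kspan P (Phi j)) -> kspan P (fun A => \sum_j Phi j A).
Proof.
move=> hP; elim: (index_enum J) => [|j r IH].
  by apply: kspan0 => A; rewrite big_nil.
by apply: eq_kspan (kspan_add (hP j) IH) => A; rewrite big_cons.
Qed.

Lemma kspan1 n (P : 'M[C]_n -> Prop) c K K' : P K -> P K' ->
  kspan P (fun A => c *: (adj K *m A *m K')).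
Proof.
move=> PK PK'; apply: (kspanD (c := c) PK PK' (kspan0 P (Phi := fun=> 0) _)) => // A.
by rewrite addr0.
Qed.

End Kraus.

(** * Expansion of tensor powers *)

Section WeightParts.
Variables (R : realType) (d : nat).
Local Notation C := (R[i]).

Lemma linear_D n2 n1 (S : 'M[C]_n2 -> 'M[C]_n1) : linear S -> {morph S : X Y / X + Y}.
Proof. by move=> lS X Y; have := lS 1 X Y; rewrite !scale1r. Qed.

Lemma linear_0 n2 n1 (S : 'M[C]_n2 -> 'M[C]_n1) : linear S -> S 0 = 0.
Proof. by move=> lS; have := linear_scalemx lS 0 0; rewrite !scale0r. Qed.

Lemma linear_bigsum n2 n1 (S : 'M[C]_n2 -> 'M[C]_n1) (J : finType) (X : J -> 'M[C]_n2) :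
  linear S -> S (\sum_j X j) = \sum_j S (X j).
Proof. by move=> lS; apply: big_morph; [exact: linear_D|exact: linear_0]. Qed.

Lemma amplL_linear n2 n1 (S : 'M[C]_n2 -> 'M[C]_n1) k :
  linear S -> linear (@amplL R n2 n1 S k).
Proof.
move=> lS c X Y; apply: mxtens_matrixP => i1 i2 j1 j2.
rewrite [RHS]mxE [(c *: amplL S X) _ _]mxE !amplLE.
set M := \matrix_(a, b) _; set M1 := \matrix_(a, b) _; set M2 := \matrix_(a, b) _.
have -> : M = c *: M1 + M2 by apply/matrixP => a b; rewrite !mxE.
by rewrite lS !mxE.
Qed.

Lemma amplR_linear k n2 n1 (S : 'M[C]_n2 -> 'M[C]_n1) :
  linear S -> linear (@amplR R k n2 n1 S).
Proof.
move=> lS c X Y; apply: mxtens_matrixP => i1 i2 j1 j2.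
rewrite [RHS]mxE [(c *: amplR S X) _ _]mxE !amplRE.
set M := \matrix_(a, b) _; set M1 := \matrix_(a, b) _; set M2 := \matrix_(a, b) _.
have -> : M = c *: M1 + M2 by apply/matrixP => a b; rewrite !mxE.
by rewrite lS !mxE.
Qed.

Lemma tensmap_linear a2 a1 b2 b1 (S1 : 'M[C]_a2 -> 'M[C]_a1)
    (S2 : 'M[C]_b2 -> 'M[C]_b1) :
  linear S1 -> linear S2 -> linear (tensmap S1 S2).
Proof.
by move=> l1 l2 c X Y; rewrite /tensmap (amplR_linear l2) (amplL_linear l1).
Qed.

Lemma tensmap_tens a2 a1 b2 b1 (S1 : 'M[C]_a2 -> 'M[C]_a1)
    (S2 : 'M[C]_b2 -> 'M[C]_b1) A B : linear S1 -> linear S2 ->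
  tensmap S1 S2 (A *t B) = S1 A *t S2 B.
Proof.
move=> l1 l2; have -> : tensmap S1 S2 (A *t B) = amplL S1 (A *t S2 B).
  congr amplL; apply: mxtens_matrixP => i1 i2 j1 j2.
  rewrite amplRE tensmxE (_ : \matrix_(a, b) _ = A i1 j1 *: B).
    by rewrite (linear_scalemx l2) mxE.
  by apply/matrixP => a b; rewrite mxE tensmxE mxE.
apply: mxtens_matrixP => i1 i2 j1 j2.
rewrite amplLE tensmxE (_ : \matrix_(a, b) _ = S2 B i2 j2 *: A).
  by rewrite (linear_scalemx l1) mxE mulrC.
by apply/matrixP => a b; rewrite mxE tensmxE mxE mulrC.
Qed.

Lemma tensmapDl a2 a1 b2 b1 (S1 S1' : 'M[C]_a2 -> 'M[C]_a1)
    (S2 : 'M[C]_b2 -> 'M[C]_b1) A :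
  tensmap (fun X => S1 X + S1' X) S2 A = tensmap S1 S2 A + tensmap S1' S2 A.
Proof. by apply/matrixP => i j; rewrite /tensmap /amplL !mxE. Qed.

Lemma tensmapZl a2 a1 b2 b1 c (S1 : 'M[C]_a2 -> 'M[C]_a1)
    (S2 : 'M[C]_b2 -> 'M[C]_b1) A :
  tensmap (fun X => c *: S1 X) S2 A = c *: tensmap S1 S2 A.
Proof. by apply/matrixP => i j; rewrite /tensmap /amplL !mxE. Qed.

Lemma tensmap_sumr a2 a1 b2 b1 (J : finType) (S1 : 'M[C]_a2 -> 'M[C]_a1)
    (S2 : J -> 'M[C]_b2 -> 'M[C]_b1) A : linear S1 ->
  tensmap S1 (fun X => \sum_j S2 j X) A = \sum_j tensmap S1 (S2 j) A.
Proof.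
move=> l1; rewrite /tensmap -(linear_bigsum _ (amplL_linear l1)); congr amplL.
apply/matrixP => i j; rewrite /amplR !mxE !summxE.
by apply: eq_bigr => l _; rewrite mxE.
Qed.

Lemma tensmapDr a2 a1 b2 b1 (S1 : 'M[C]_a2 -> 'M[C]_a1)
    (S2 S2' : 'M[C]_b2 -> 'M[C]_b1) A : linear S1 ->
  tensmap S1 (fun X => S2 X + S2' X) A = tensmap S1 S2 A + tensmap S1 S2' A.
Proof.
move=> l1; rewrite /tensmap -(linear_D (amplL_linear l1)); congr amplL.
by apply/matrixP => i j; rewrite /amplR !mxE.
Qed.

Lemma tensmapZr a2 a1 b2 b1 c (S1 : 'M[C]_a2 -> 'M[C]_a1)
    (S2 : 'M[C]_b2 -> 'M[C]_b1) A : linear S1 ->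
  tensmap S1 (fun X => c *: S2 X) A = c *: tensmap S1 S2 A.
Proof.
move=> l1; rewrite /tensmap -(linear_scalemx (amplL_linear l1)); congr amplL.
by apply/matrixP => i j; rewrite /amplR !mxE.
Qed.

Lemma tensmap0r a2 a1 b2 b1 (S1 : 'M[C]_a2 -> 'M[C]_a1)
    (S2 : 'M[C]_b2 -> 'M[C]_b1) A : linear S1 -> (forall X, S2 X = 0) ->
  tensmap S1 S2 A = 0.
Proof.
move=> l1 h; rewrite /tensmap -(linear_0 (amplL_linear l1)); congr amplL.
by apply/matrixP => i j; rewrite /amplR mxE h !mxE.
Qed.

Lemma tensmap_id a b A :
  tensmap (fun X : 'M[C]_a => X) (fun X : 'M[C]_b => X) A = A.
Proof.
apply: mxtens_matrixP => i1 i2 j1 j2.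
by rewrite /tensmap amplLE mxE amplRE mxE.
Qed.

Variable L : 'M[C]_d -> 'M[C]_d.
Hypothesis L_linear : linear L.

(* The part of the [n]-th tensor power of [id + L] with exactly [j] factors [L]. *)
Fixpoint wpart n : nat -> 'M[C]_(pw d n) -> 'M[C]_(pw d n) :=
  match n as n0 return nat -> 'M[C]_(pw d n0) -> 'M[C]_(pw d n0) with
  | 0 => fun j A => if j is 0 then A else 0
  | n'.+1 => fun j A =>
      tensmap (fun X => X) (@wpart n' j) A +
      (if j is j'.+1 then tensmap L (@wpart n' j') A else 0)
  end.

Lemma wpartS n j A : @wpart n.+1 j A =
  tensmap (fun X => X) (@wpart n j) A +
  (if j is j'.+1 then tensmap L (@wpart n j') A else 0).
Proof. by []. Qed.

Let id_linear n : linear (fun X : 'M[C]_n => X).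
Proof. by []. Qed.

Lemma wpart_linear n j : linear (@wpart n j).
Proof.
elim: n j => [|n IH] [|j] c X Y //=; rewrite ?scaler0 ?addr0 //.
  by rewrite (tensmap_linear (@id_linear d) (IH 0)) .
rewrite (tensmap_linear (@id_linear d) (IH j.+1)) (tensmap_linear L_linear (IH j)).
by rewrite scalerDr !addrA; congr (_ + _); rewrite addrAC.
Qed.

Lemma wpart0 n A : @wpart n 0 A = A.
Proof.
elim: n A => [|n IH] A //=; rewrite addr0 -[RHS]tensmap_id.
exact: eq_tensmap.
Qed.

Lemma wpart_gt n j A : (n < j)%N -> @wpart n j A = 0.
Proof.
elim: n j A => [|n IH] [|j] A //= nj.
have z (S : 'M[C]_d -> 'M[C]_d) k : linear S -> (n < k)%N ->
    tensmap S (@wpart n k) A = 0.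
  by move=> lS nk; apply: tensmap0r => // X; exact: IH.
by rewrite !z ?addr0 // ltnW.
Qed.

Lemma wpart_unit n j : L 1%:M = 0 -> (0 < j)%N -> @wpart n j 1%:M = 0.
Proof.
move=> L1; elim: n j => [|n IH] [|j] //= _; rewrite -tensmx11.
rewrite !tensmap_tens //; try exact: wpart_linear.
by rewrite L1 IH // tensmx0 tens0mx addr0.
Qed.

Lemma tpow_wpart n A :
  tpow (fun X => X + L X) A = \sum_(j < n.+1) @wpart n j A.
Proof.
elim: n A => [|n IH] A; first by rewrite big_ord_recr big_ord0 /= add0r.
rewrite [LHS]/= (eq_tensmap A (fun=> erefl) IH).
rewrite tensmapDl !tensmap_sumr //.
under [RHS]eq_bigr do rewrite wpartS.
(* On the right, the terms with the identity on the first site have a surplus index [n.+1], which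
   vanishes by [wpart_gt]; those with [L] there start at [j = 1], so their index is shifted by
   one. *)
rewrite [RHS]big_split; congr (_ + _).
  rewrite [RHS]big_ord_recr -[LHS]addr0; congr (_ + _).
  by rewrite tensmap0r // => X; exact: wpart_gt.
by rewrite [RHS]big_ord_recl -[LHS]add0r; congr (_ + _); apply: eq_bigr => j _.
Qed.

(** There are ['C(n, j)] placements of the factors [L], each of cb-norm at most [delta ^+ j]; the
    recursion of [wpart] is Pascal's rule. *)
Lemma wpart_cbb n j delta : 0 <= delta -> cbb L delta ->
  cbb (@wpart n j) ('C(n, j)%:R * delta ^+ j).
Proof.
move=> d0 hL; elim: n j => [|n IH] j.
  case: j => [|j] /=; first by rewrite bin0 mulr1; exact: cbb_id.
  by rewrite bin0n mul0r; exact: cbb_zero.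
have b0 i : 0 <= 'C(n, i)%:R * delta ^+ i by rewrite mulr_ge0 // exprn_ge0.
have h1 := cbb_tensmap (b0 j) (@cbb_id R d) (IH j).
rewrite mul1r in h1; case: j h1 => [|j] h1.
  by rewrite bin0 -(bin0 n); apply: eq_cbb h1 => X /=; rewrite addr0.
have h2 := cbb_tensmap (b0 j) hL (IH j).
have -> : 'C(n.+1, j.+1)%:R * delta ^+ j.+1 =
    'C(n, j.+1)%:R * delta ^+ j.+1 + delta * ('C(n, j)%:R * delta ^+ j).
  by rewrite binS natrD exprS; ring.
by apply: eq_cbb (cbbD _ _ h1 h2) => //; rewrite ?b0 // mulr_ge0.
Qed.

(** Elementary tensors with arbitrary operators at [j] marked sites and the identity at all
    others. *)
Inductive locop : forall n, nat -> 'M[C]_(pw d n) -> Prop :=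
| locop0 : @locop 0 0 1%:M
| locop_id n j (K : 'M[C]_(pw d n)) : locop j K ->
    @locop n.+1 j ((1%:M : 'M[C]_d) *t K)
| locop_site n j (A : 'M[C]_d) (K : 'M[C]_(pw d n)) : locop j K ->
    @locop n.+1 j.+1 (A *t K).

(** Matrix units make any linear map a sum of sandwiches, since [E_ki A E_jl = A_ij E_kl]; the
    coefficient is the [(k, l)] entry of [L E_ij]. *)
Lemma linear_delta A : L A = \sum_(q : ('I_d * 'I_d) * ('I_d * 'I_d))
  L (delta_mx q.1.1 q.1.2) q.2.1 q.2.2 *:
    (adj (delta_mx q.1.1 q.2.1) *m A *m delta_mx q.1.2 q.2.2).
Proof.
rewrite [in LHS](matrix_sum_delta A) linear_bigsum //.
rewrite -(pair_bigA _ (fun p q : 'I_d * 'I_d => L (delta_mx p.1 p.2) q.1 q.2 *: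
   (adj (delta_mx p.1 q.1) *m A *m delta_mx p.2 q.2))) /=.
rewrite -(pair_bigA _ (fun i j => \sum_(q : 'I_d * 'I_d) L (delta_mx i j) q.1 q.2 *:
   (adj (delta_mx i q.1) *m A *m delta_mx j q.2))) /=.
apply: eq_bigr => i _; rewrite linear_bigsum //; apply: eq_bigr => j _.
rewrite (linear_scalemx L_linear) [L _ in LHS]matrix_sum_delta scaler_sumr.
rewrite -(pair_bigA _ (fun k l => L (delta_mx i j) k l *:
   (adj (delta_mx i k) *m A *m delta_mx j l))) /=.
apply: eq_bigr => k _; rewrite scaler_sumr; apply: eq_bigr => l _.
rewrite scalerA mulrC -scalerA; congr (_ *: _); rewrite adj_delta.
apply/matrixP => a b; rewrite !mxE (bigD1 j) //= big1 ?addr0 => [|j' /negbTE jj].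
  rewrite !mxE (bigD1 i) //= big1 ?addr0 => [|i' /negbTE ii].
    rewrite !mxE !eqxx !andbT /=.
    by case: eqP => _; case: eqP => _ /=; rewrite ?(mul1r, mulr1, mul0r, mulr0).
  by rewrite mxE ii andbF mul0r.
by rewrite [delta_mx _ _ _ _]mxE jj mulr0.
Qed.

Lemma kspan_tensmap n (S : 'M[C]_d -> 'M[C]_d) Phi (P : 'M[C]_d -> Prop)
    (Q : 'M[C]_(pw d n) -> Prop) (Q' : 'M[C]_(pw d n.+1) -> Prop) :
  linear S -> kspan P S -> kspan Q Phi ->
  (forall A K, P A -> Q K -> Q' (A *t K)) -> kspan Q' (tensmap S Phi).
Proof.
move=> lS hS hPhi PQ.
(* With a single sandwich on the second factor, only the expansion of [S] remains. *)
have one K K' : Q K -> Q K' -> kspan Q' (tensmap S (fun X => adj K *m X *m K')).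
  move=> QK QK'; elim: hS => {lS} [S' h|c A A' S' S'' PA PA' hS IH h].
    apply: kspan0 => B; apply/matrixP => i k.
    by rewrite /tensmap /amplL mxE h !mxE.
  apply: (kspanD (c := c) (PQ _ _ PA QK) (PQ _ _ PA' QK') IH) => B.
  rewrite (eq_tensmap B h (fun=> erefl)) tensmapDl tensmapZl.
  by rewrite tensmap_mul adj_tens.
elim: hPhi => [Phi' h|c K K' Phi' Phi'' QK QK' hP IH h].
  apply: kspan0 => B; exact: tensmap0r.
apply: eq_kspan (kspan_add (kspan_scale c (one K K' QK QK')) IH) => B.
by rewrite -tensmapZr // -tensmapDr //; apply: eq_tensmap.
Qed.

Lemma wpart_kspan n j : kspan (@locop n j) (@wpart n j).
Proof.
have kid n' : kspan (fun K : 'M[C]_n' => K = 1%:M) (fun X => X).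
  apply: eq_kspan (@kspan1 _ _ (fun K => K = 1%:M) 1 1%:M 1%:M erefl erefl) => X.
  by rewrite adj_1mx mul1mx mulmx1 scale1r.
have kL : kspan (fun=> True) L.
  apply: (eq_kspan (fun A => esym (linear_delta A))).
  by apply: kspan_sum => q; exact: kspan1.
elim: n j => [|n IH] j.
  case: j => [|j] /=; last exact: kspan0.
  apply: eq_kspan (@kspan1 _ _ (@locop 0 0) 1 1%:M 1%:M locop0 locop0) => X.
  by rewrite adj_1mx mul1mx mulmx1 scale1r.
have h1 : kspan (@locop n.+1 j) (tensmap (fun X => X) (wpart j)).
  by apply: (kspan_tensmap _ (@kid d) (IH j)) => // _ K -> hK; exact: locop_id.
case: j h1 => [|j] h1; first by apply: eq_kspan h1 => X /=; rewrite addr0.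
apply: (kspan_add h1); apply: (kspan_tensmap _ kL (IH j)) => // A K _ hK.
exact: locop_site.
Qed.

End WeightParts.

(** * Linear spans of operators *)

Section LinearSpan.
Variable R : realType.
Local Notation C := (R[i]).

Inductive lspan m n (P : 'M[C]_(m, n) -> Prop) : 'M[C]_(m, n) -> Prop :=
| lspan0 : lspan P 0
| lspanD c K K' : P K -> lspan P K' -> lspan P (c *: K + K').

Lemma lspan_add m n (P : 'M[C]_(m, n) -> Prop) K K' :
  lspan P K -> lspan P K' -> lspan P (K + K').
Proof.
move=> hK hK'; elim: hK => [|c K1 K2 P1 _ IH]; first by rewrite add0r.
by rewrite -addrA; exact: lspanD.
Qed.

Lemma lspan_scale m n (P : 'M[C]_(m, n) -> Prop) c K :
  lspan P K -> lspan P (c *: K).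
Proof.
elim => [|c' K1 K2 P1 _ IH]; first by rewrite scaler0; exact: lspan0.
by rewrite scalerDr scalerA; exact: lspanD.
Qed.

Lemma lspan_gen m n (P : 'M[C]_(m, n) -> Prop) K : P K -> lspan P K.
Proof.
move=> PK; rewrite -[K]scale1r -[_ *: _]addr0.
by apply: lspanD => //; exact: lspan0.
Qed.

Lemma lspan_sum m n (P : 'M[C]_(m, n) -> Prop) (J : finType) (K : J -> 'M[C]_(m, n)) :
  (forall j, lspan P (K j)) -> lspan P (\sum_j K j).
Proof.
by move=> hK; apply: big_ind => //; [exact: lspan0 | exact: lspan_add].
Qed.

Lemma lspan_tens m n p q (P : 'M[C]_(m, n) -> Prop) (Q : 'M[C]_(p, q) -> Prop)
    (S : 'M[C]_(m * p, n * q) -> Prop) A B :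
  lspan P A -> lspan Q B -> (forall A B, P A -> Q B -> S (A *t B)) ->
  lspan S (A *t B).
Proof.
move=> hA hB PQ.
have tD c (A1 A2 : 'M[C]_(m, n)) (B' : 'M[C]_(p, q)) :
    (c *: A1 + A2) *t B' = c *: (A1 *t B') + A2 *t B'.
  by apply/matrixP => i j; rewrite !mxE mulrDl mulrA.
have tD' c (A' : 'M[C]_(m, n)) (B1 B2 : 'M[C]_(p, q)) :
    A' *t (c *: B1 + B2) = c *: (A' *t B1) + A' *t B2.
  by apply/matrixP => i j; rewrite !mxE mulrDr mulrCA.
elim: hA => [|c A1 A2 PA _ IH]; first by rewrite tens0mx; exact: lspan0.
rewrite tD; apply: lspan_add IH; apply: lspan_scale.
elim: hB => [|c' B1 B2 QB _ IH']; first by rewrite tensmx0; exact: lspan0.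
by rewrite tD'; apply: lspanD => //; exact: PQ.
Qed.

End LinearSpan.

(** * Error correction *)

Section Decoder.
Variables (R : realType) (N m : nat) (J : finType).
Local Notation C := (R[i]).
Variables (V : 'M[C]_(N, m.+1)) (F : J -> 'M[C]_N).
(** The Knill-Laflamme conditions in nondegenerate form: the errors [F p] carry the code space
    isometrically onto mutually orthogonal subspaces. *)
Hypothesis VFFV : forall p q,
  adj V *m adj (F p) *m (F q *m V) = if p == q then 1%:M else 0.
Hypothesis V1 : adj V *m V = 1%:M.

(** By [VFFV] this is the orthogonal projection onto the sum of the error subspaces, and [Pi]
    projects onto the complement. *)
Let S := \sum_p F p *m V *m adj (F p *m V).
Let Pi := 1%:M - S.

Definition encoder := kraus (fun _ : unit => adj V).

(** The left summands undo the error [p] on its subspace. The right ones fill the complement with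
    the scalar [X 0 0], which makes the decoder unital. *)
Definition decoder_kraus (x : J + 'I_N) : 'M[C]_(N, m.+1) :=
  match x with inl p => F p *m V | inr l => Pi *m delta_mx l 0 end.

Definition decoder := kraus decoder_kraus.

Lemma encoderE A : encoder A = adj V *m A *m V.
Proof. by rewrite /encoder /kraus (big_pred1 tt) ?adjK // => -[]. Qed.

Lemma encoder_kraus1 : \sum_(u : unit) adj V *m adj (adj V) = 1%:M.
Proof. by rewrite (big_pred1 tt) ?adjK // => -[]. Qed.

Let FV_S p : S *m (F p *m V) = F p *m V.
Proof.
rewrite /S mulmx_suml (bigD1 p) //= big1 ?addr0 => [|q /negbTE qp].
  by rewrite adjM -mulmxA VFFV eqxx mulmx1.
by rewrite adjM -mulmxA VFFV qp mulmx0.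
Qed.

Let S_adj : adj S = S.
Proof. by rewrite /S adj_sum; apply: eq_bigr => p _; rewrite adjM adjK. Qed.

Let S_idem : S *m S = S.
Proof.
by rewrite {2 3}/S mulmx_sumr; apply: eq_bigr => p _; rewrite mulmxA FV_S.
Qed.

Let Pi_adj : adj Pi = Pi.
Proof. by rewrite /Pi adjB adj_1mx S_adj. Qed.

Let Pi_idem : Pi *m Pi = Pi.
Proof. by rewrite {1}/Pi mulmxBl mul1mx /Pi mulmxBr mulmx1 S_idem subrr subr0. Qed.

Let Pi_FV p : Pi *m (F p *m V) = 0.
Proof. by rewrite /Pi mulmxBl mul1mx FV_S subrr. Qed.

Let sum_delta (X : 'M[C]_m.+1) :
  \sum_(l < N) delta_mx l 0 *m X *m delta_mx 0 l = (X 0 0)%:M :> 'M[C]_N.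
Proof.
apply/matrixP => i j; rewrite summxE mxE.
have E l : (delta_mx l 0 *m X *m delta_mx 0 l) i j =
    (i == l)%:R * X 0 0 * (j == l)%:R :> C.
  rewrite mxE (bigD1 0) //= big1 ?addr0 => [|k /negbTE k0]; last first.
    by rewrite [delta_mx 0 l _ _]mxE k0 mulr0.
  rewrite [delta_mx 0 l _ _]mxE eqxx /=; congr (_ * _).
  rewrite mxE (bigD1 0) //= big1 ?addr0 => [|k /negbTE k0].
    by rewrite mxE eqxx andbT.
  by rewrite mxE k0 andbF mul0r.
under eq_bigr do rewrite E.
rewrite (bigD1 i) //= big1 ?addr0 => [|l /negbTE li]; last first.
  by rewrite eq_sym li !mul0r.
by rewrite eqxx mul1r eq_sym; case: eqP => _; rewrite ?mulr1 ?mulr0 ?mulr1n ?mulr0n.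
Qed.

Lemma decoderE X :
  decoder X = \sum_p F p *m V *m X *m adj (F p *m V) + X 0 0 *: Pi.
Proof.
rewrite /decoder /kraus big_sumType /=; congr (_ + _).
have -> : X 0 0 *: Pi = Pi *m (\sum_(l < N) delta_mx l 0 *m X *m delta_mx 0 l) *m Pi.
  by rewrite sum_delta mul_mx_scalar -scalemxAl Pi_idem.
rewrite mulmx_sumr mulmx_suml; apply: eq_bigr => l _.
by rewrite adjM adj_delta Pi_adj !mulmxA.
Qed.

Lemma decoder_kraus1 : \sum_x decoder_kraus x *m adj (decoder_kraus x) = 1%:M.
Proof.
have := decoderE 1%:M; rewrite /decoder /kraus.
under eq_bigr do rewrite mulmx1.
move=> ->; under eq_bigr do rewrite mulmx1.
by rewrite mxE eqxx scale1r addrC /Pi subrK.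
Qed.

Let correct_pair p q X :
  adj V *m adj (F p) *m decoder X *m (F q *m V) = if p == q then X else 0.
Proof.
have asc a (A : 'M[C]_(a, N)) (B : 'M[C]_(N, m.+1)) B' D :
  A *m (B *m X *m B') *m D = (A *m B) *m X *m (B' *m D) :> 'M[C]_(a, m.+1).
  by rewrite !mulmxA.
rewrite decoderE mulmxDr mulmxDl -scalemxAr -scalemxAl -[_ *m Pi *m _]mulmxA Pi_FV.
rewrite mulmx0 scaler0 addr0 mulmx_sumr mulmx_suml (bigD1 p) //= big1 ?addr0.
  rewrite asc adjM !VFFV eqxx mul1mx.
  by case: eqP => _; rewrite ?mulmx1 ?mulmx0.
by move=> r /negbTE rp; rewrite asc VFFV eq_sym rp !mul0mx.
Qed.

(** Sandwiched between encoder and decoder, [Phi] becomes [l] times the identity. Recording that [l]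
    is also the encoded value of [Phi 1] lets it be read off: 0 if [Phi] kills the identity, 1 if
    [Phi] is unital. *)
Definition corrects (Phi : 'M[C]_N -> 'M[C]_N) := exists l : C,
  encoder (Phi 1%:M) = l%:M /\ forall X, encoder (Phi (decoder X)) = l *: X.

Let errs K := exists p, K = F p.

Let decoder1 : decoder 1%:M = 1%:M.
Proof. by case: (kraus_channel decoder_kraus1) => _ []. Qed.

Lemma corrects_lspan K K' : lspan errs K -> lspan errs K' ->
  corrects (fun A => adj K *m A *m K').
Proof.
move=> hK hK'.
(* The decoder is unital, so the first half of [corrects] is the second one at [X = 1]. *)
suff [l hl] : exists l : C,
    forall X, adj V *m (adj K *m decoder X *m K') *m V = l *: X.
  exists l; split => [|X]; last by rewrite encoderE.
  by rewrite encoderE -decoder1 hl scalemx1.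
elim: hK => [|c K1 K2 [p ->] _ [l2 IH]].
  by exists 0 => X; rewrite adj0 !mul0mx mulmx0 mul0mx scale0r.
suff [l1 hl] : exists l : C,
    forall X, adj V *m (adj (F p) *m decoder X *m K') *m V = l *: X.
  exists (conjc c * l1 + l2) => X; rewrite adjD adj_scale !mulmxDl mulmxDr mulmxDl IH.
  by rewrite -!scalemxAl -scalemxAr -scalemxAl hl scalerA scalerDl.
elim: hK' => [|c' K3 K4 [q ->] _ [l4 IH4]].
  by exists 0 => X; rewrite !mulmx0 mul0mx scale0r.
exists (c' * (p == q)%:R + l4) => X.
rewrite mulmxDr mulmxDr mulmxDl IH4 scalerDl; congr (_ + _).
rewrite -!scalemxAr -scalemxAl -scalerA; congr (_ *: _).
rewrite !mulmxA -[_ *m F q *m V]mulmxA correct_pair.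
by case: eqP => _; rewrite ?scale1r ?scale0r.
Qed.

Lemma corrects_kspan P Phi : (forall K, P K -> lspan errs K) ->
  kspan P Phi -> corrects Phi.
Proof.
move=> hP; elim => [Phi' h|c K K' Phi' Phi'' PK PK' _ [l2 [h1 h2]] h].
  exists 0; split => [|X]; rewrite h encoderE mulmx0 mul0mx ?scale0r //.
  by rewrite -scalemx1 scale0r.
have [l [h3 h4]] := corrects_lspan (hP _ PK) (hP _ PK').
have encD A B : encoder (c *: A + B) = c *: encoder A + encoder B.
  exact: kraus_linear.
exists (c * l + l2); split => [|X]; rewrite h encD.
  by rewrite h3 h1 scale_scalar_mx -raddfD.
by rewrite h4 h2 scalerA scalerDl.
Qed.

Lemma corrects_unit0 Phi X : corrects Phi -> Phi 1%:M = 0 ->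
  encoder (Phi (decoder X)) = 0.
Proof.
case=> l [h1 ->] P0; move: h1; rewrite P0 encoderE mulmx0 mul0mx.
by move/matrixP/(_ 0 0); rewrite !mxE eqxx mulr1n => <-; rewrite scale0r.
Qed.

Lemma corrects_unit1 Phi X : corrects Phi -> Phi 1%:M = 1%:M ->
  encoder (Phi (decoder X)) = X.
Proof.
case=> l [h1 ->] P1; move: h1; rewrite P1 encoderE mulmx1 V1.
by move/matrixP/(_ 0 0); rewrite !mxE eqxx !mulr1n => <-; rewrite scale1r.
Qed.

End Decoder.

(** * Graph codes *)

Section Weight.
Variables (F : finFieldType) (n : nat).
Implicit Types a b : 'rV[F]_n.

(** Number of sites at which the Pauli operator with shift [a] and phase [b] differs from the
    identity. *)
Definition wt a b : nat := (\sum_i ((a 0%R i != 0%R) || (b 0%R i != 0%R)))%N.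

Lemma wt_sub a b a' b' : (wt (a' - a) (b' - b) <= wt a b + wt a' b')%N.
Proof.
rewrite /wt -big_split /=; apply: leq_sum => i _; rewrite !mxE.
case: (eqVneq (a 0 i) 0) => [->|_] /=; last by rewrite (leq_trans (leq_b1 _)).
case: (eqVneq (b 0 i) 0) => [->|_] /=; last by rewrite (leq_trans (leq_b1 _)).
by rewrite !subr0.
Qed.

Lemma wt0 : wt 0 0 = 0%N.
Proof. by rewrite /wt big1 // => i _; rewrite mxE eqxx. Qed.

End Weight.

Lemma wt_row (F : finFieldType) n a0 b0 (a b : 'rV[F]_n) :
  wt (row_mx a0%:M a : 'rV_(1 + n)) (row_mx b0%:M b : 'rV_(1 + n)) =
  (((a0 != 0%R) || (b0 != 0%R)) + wt a b)%N.
Proof.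
rewrite /wt big_split_ord /= big_ord1 !row_mxEl !mxE !mulr1n; congr (_ + _)%N.
by apply: eq_bigr => i _; rewrite !row_mxEr.
Qed.

(** * Pauli operators and characters *)

Section Pauli.
Variables (R : realType) (F : finFieldType) (chi : F -> R[i]).
Local Notation C := (R[i]).
Hypothesis chiD : forall x y, chi (x + y) = chi x * chi y.
Hypothesis chi0 : chi 0 = 1.
Hypothesis chiJ : forall x, conjc (chi x) = chi (- x).
Hypothesis chi_neq1 : exists x, chi x != 1.

Definition dot n (a b : 'rV[F]_n) : F := (a *m b^T) 0 0.

Lemma dotDl n (a a' b : 'rV[F]_n) : dot (a + a') b = dot a b + dot a' b.
Proof. by rewrite /dot mulmxDl mxE. Qed.

Lemma dotDr n (a b b' : 'rV[F]_n) : dot a (b + b') = dot a b + dot a b'.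
Proof. by rewrite /dot linearD mulmxDr mxE. Qed.

Lemma dotNl n (a b : 'rV[F]_n) : dot (- a) b = - dot a b.
Proof. by rewrite /dot mulNmx mxE. Qed.

Lemma dotC n (a b : 'rV[F]_n) : dot a b = dot b a.
Proof. by rewrite /dot -[RHS]trace_mx11 -mxtrace_tr trmx_mul trmxK trace_mx11. Qed.

Lemma dot0l n (b : 'rV[F]_n) : dot 0 b = 0.
Proof. by rewrite /dot mul0mx mxE. Qed.

Lemma dot_row n m (a b : 'rV[F]_n) (a' b' : 'rV[F]_m) :
  dot (row_mx a a') (row_mx b b') = dot a b + dot a' b'.
Proof. by rewrite /dot tr_row_mx mul_row_col mxE. Qed.

(** Orthogonality of characters: for [v != 0] some [u] has [chi (dot v u) != 1], and translating the
    summation variable by [u] multiplies the sum by this number. *)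
Lemma sum_chi n (v : 'rV[F]_n) :
  \sum_y chi (dot v y) = if v == 0 then (#|F| ^ n)%:R else 0.
Proof.
have [->|v0] := eqVneq v 0.
  under eq_bigr do rewrite dot0l chi0.
  by rewrite sumr_const card_mx mul1n.
have [i vi] : exists i, v 0 i != 0.
  apply/existsP; apply: contraNT v0; rewrite negb_exists => /forallP h.
  apply/eqP/matrixP => a i; rewrite ord1 mxE; apply/eqP.
  by have := h i; rewrite negbK.
have [x x1] := chi_neq1; pose u : 'rV[F]_n := (x / v 0 i) *: delta_mx 0 i.
have vu : dot v u = x.
  rewrite /dot linearZ /= trmx_delta -scalemxAr mxE -colE mxE.
  by rewrite mulrVK // unitfE.
set s := \sum_y _; have : s = chi x * s.
  rewrite {1}/s (reindex_inj (addrI u)) mulr_sumr; apply: eq_bigr => y _.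
  by rewrite dotDr vu chiD.
move/eqP; rewrite -subr_eq0 -{1}[s]mul1r -mulrBl mulf_eq0 => /orP[|/eqP//].
by rewrite subr_eq0 eq_sym (negbTE x1).
Qed.

Lemma sum_chi1 (x : F) : \sum_y chi (x * y) = if x == 0 then #|F|%:R else 0.
Proof.
have := @sum_chi 1 x%:M; rewrite expn1.
have -> : ((x%:M : 'rV_1) == 0) = (x == 0).
  apply/eqP/eqP => [/matrixP/(_ 0 0)|->]; first by rewrite !mxE mulr1n.
  by apply/matrixP => i j; rewrite !mxE mul0rn.
move=> <-; rewrite [RHS](reindex (fun y => y%:M)) /=; last first.
  exists (fun y => y 0 0) => y _; first by rewrite mxE mulr1n.
  by rewrite -mx11_scalar.
by apply: eq_bigr => y _; rewrite /dot tr_scalar_mx -scalar_mxM mxE mulr1n.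
Qed.

Variables (d : nat) (e : 'I_d -> F).
Hypothesis e_bij : bijective e.

(** Labels the basis of the tensor power by vectors over [F]; following the recursion of [pw], the
    first site becomes the first coordinate. *)
Fixpoint dec n : 'I_(pw d n) -> 'rV[F]_n :=
  match n as n0 return 'I_(pw d n0) -> 'rV[F]_n0 with
  | 0 => fun=> 0
  | n'.+1 => fun i => (row_mx (e (mxtens_unindex i).1)%:M
                         (@dec n' (mxtens_unindex i).2) : 'rV_(1 + n'))
  end.

Lemma card_F : #|F| = d.
Proof. by rewrite -(bij_eq_card e_bij) card_ord. Qed.

Lemma dec_bij n : bijective (@dec n).
Proof.
apply: inj_card_bij; last first.
  rewrite card_mx card_ord mul1n card_F.
  by elim: n => //= n IH; rewrite expnS leq_mul2l IH orbT.
elim: n => [i j _|n IH i j]; first by rewrite !ord1.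
move=> /(@eq_row_mx F 1 1 n _ _ _ _)[/matrixP/(_ 0 0)]; rewrite !mxE !mulr1n => /(bij_inj e_bij) h1.
move=> /IH h2; rewrite -(mxtens_unindexK i) -(mxtens_unindexK j).
by rewrite [mxtens_unindex i]surjective_pairing h1 h2 -surjective_pairing.
Qed.

Lemma decE n i1 i2 : @dec n.+1 (mxtens_index (i1, i2)) =
  row_mx (e i1)%:M (dec i2) :> 'rV_(1 + n).
Proof. by rewrite /dec -/dec mxtens_indexK. Qed.

Lemma sum_dec n (g : 'rV[F]_n -> C) : \sum_i g (dec i) = \sum_y g y.
Proof. by rewrite [RHS](reindex (@dec n)) //; exact/onW_bij/dec_bij. Qed.

Lemma sum_dec1 n (g : 'rV[F]_n -> C) v :
  \sum_(i : 'I_(pw d n)) (if dec i == v then g (dec i) else 0) = g v.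
Proof.
rewrite (sum_dec (fun y => if y == v then g y else 0)) -big_mkcond.
by rewrite big_pred1_eq.
Qed.

(** The Weyl operator sending the basis vector [|y>] to [chi (dot b y) |y + a>]. *)
Definition pauli n (a b : 'rV[F]_n) : 'M[C]_(pw d n) :=
  \matrix_(i, j) if dec i == dec j + a then chi (dot b (dec j)) else 0.

Definition pauli1 (a b : F) : 'M[C]_d :=
  \matrix_(i, j) if e i == e j + a then chi (b * e j) else 0.

Lemma pauli_tens n a0 b0 (a b : 'rV[F]_n) :
  pauli1 a0 b0 *t pauli a b =
  @pauli n.+1 (row_mx a0%:M a : 'rV_(1 + n)) (row_mx b0%:M b : 'rV_(1 + n)).
Proof.
apply: mxtens_matrixP => i1 i2 j1 j2; rewrite tensmxE !mxE !decE.
rewrite (@add_row_mx _ 1 1 n) (@dot_row 1 n) chiD.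
have -> : (row_mx (e i1)%:M (dec i2) == row_mx ((e j1)%:M + a0%:M) (dec j2 + a)
    :> 'rV_(1 + n)) = (e i1 == e j1 + a0) && (dec i2 == dec j2 + a).
  rewrite -raddfD /=; apply/eqP/andP => [/eq_row_mx[/matrixP/(_ 0 0)]|[/eqP-> /eqP->]//].
  by rewrite !mxE !mulr1n => -> ->; rewrite !eqxx.
have -> : dot (b0%:M : 'rV_1) (e j1)%:M = b0 * e j1.
  by rewrite /dot tr_scalar_mx -scalar_mxM mxE mulr1n.
by case: eqP => _; case: eqP => _ /=; rewrite ?mul0r ?mulr0.
Qed.

Lemma pauli00 n : @pauli n 0 0 = 1%:M.
Proof.
apply/matrixP => i j; rewrite !mxE addr0 dot0l chi0 (bij_eq (dec_bij n)).
by case: eqP.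
Qed.

Lemma pauli1_00 : pauli1 0 0 = 1%:M.
Proof.
apply/matrixP => i j; rewrite !mxE addr0 mul0r chi0 (bij_eq e_bij).
by case: eqP.
Qed.

(** Weyl relation: two errors combine, up to a phase, into the single error of their differences, so
    the error-correction conditions concern one Pauli operator at a time. *)
Lemma adj_pauli_mul n (a b a' b' : 'rV[F]_n) :
  adj (pauli a b) *m pauli a' b' =
  chi (- dot b (a' - a)) *: pauli (a' - a) (b' - b).
Proof.
apply/matrixP => i j; rewrite !mxE.
(* The summand is expressed through [dec s], so that [sum_dec1] leaves only the row with
   [dec s = dec j + a']. *)
pose g s := (if s == dec i + a then chi (- dot b (dec i)) else 0) *
  chi (dot b' (dec j)).
rewrite (eq_bigr (fun s => if dec s == dec j + a' then g (dec s) else 0)).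
  rewrite sum_dec1 /g.
  have -> : (dec j + a' == dec i + a) = (dec i == dec j + (a' - a)).
    by rewrite addrA eq_sym [RHS]eq_sym subr_eq eq_sym.
  case: eqP => [->|_]; last by rewrite mul0r mulr0.
  by rewrite -!chiD dotDr dotDl dotNl opprD; congr chi; ring.
move=> s _; rewrite adjE !mxE /g; case: eqP => [->|_]; case: eqP => _;
  by rewrite ?chiJ ?conjc0 ?mul0r ?mulr0.
Qed.

(** Fourier inversion: the shift by [e i - e j], averaged over all phases [b] with weight
    [chi (- (b * e j))], keeps only column [j] and gives the matrix unit. *)
Lemma pauli1_span A : lspan (fun K => exists a b, K = pauli1 a b) A.
Proof.
rewrite (matrix_sum_delta A); apply: lspan_sum => i; apply: lspan_sum => j.
apply: lspan_scale.
have -> : delta_mx i j = \sum_b ((#|F|%:R)^-1 * chi (- (b * e j))) *: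
    pauli1 (e i - e j) b.
  apply/matrixP => k l; rewrite summxE !mxE.
  under eq_bigr do rewrite !mxE.
  have [kl|kl] := eqVneq (e k) (e l + (e i - e j)).
    under eq_bigr do rewrite -mulrA -chiD -mulrN -mulrDr addrC mulrC [_ * (_ - _)]mulrC.
    rewrite -mulr_suml sum_chi1 subr_eq0 (bij_eq e_bij) eq_sym.
    have [lj|lj] := eqVneq l j; last by rewrite mul0r andbF.
    rewrite mulfV; last by rewrite pnatr_eq0 -lt0n; apply/card_gt0P; exists 0.
    move: kl; rewrite lj addrCA subrr addr0 => /(bij_inj e_bij) ->.
    by rewrite eqxx.
  rewrite big1 => [|b _]; last by rewrite mulr0.
  case: eqP => // ki; case: eqP => // lj; case/negP: kl.
  by rewrite ki lj addrCA subrr addr0.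
apply: lspan_sum => b; apply: lspan_scale; apply: lspan_gen.
by exists (e i - e j), b.
Qed.

Definition pauli_le n j (K : 'M[C]_(pw d n)) :=
  exists a b, (wt a b <= j)%N /\ K = pauli a b.

Lemma locop_span n j (K : 'M[C]_(pw d n)) : locop j K -> lspan (pauli_le j) K.
Proof.
elim => {n j K} [|n j K _ IH|n j A K _ IH].
- by apply: lspan_gen; exists 0, 0; rewrite wt0 pauli00.
- apply: (lspan_tens (P := fun K => K = 1%:M) _ IH); first exact: lspan_gen.
  move=> _ _ -> [a [b [ab ->]]].
  exists (row_mx 0%:M a : 'rV_(1 + n)), (row_mx 0%:M b : 'rV_(1 + n)).
  by rewrite wt_row eqxx -pauli1_00 pauli_tens.
apply: (lspan_tens (pauli1_span A) IH).
move=> _ _ [a0 [b0 ->]] [a [b [ab ->]]].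
exists (row_mx a0%:M a : 'rV_(1 + n)), (row_mx b0%:M b : 'rV_(1 + n)).
by rewrite wt_row pauli_tens -add1n leq_add //; case: (_ || _).
Qed.

(** * Matrix elements of Pauli operators between code words *)

Section GraphCode.
Variables (k n M : nat) (G : 'M[F]_(k + n)) (iota : 'I_M -> 'rV[F]_k).
Hypothesis iota_inj : injective iota.

Definition qform (z : 'rV[F]_(k + n)) : F := dot (z *m G) z.

Lemma qformD z u : qform (z + u) = qform z + qform u + dot (u *m (G + G^T)) z.
Proof.
rewrite /qform mulmxDl !dotDl !dotDr mulmxDr dotDl.
have -> : dot (z *m G) u = dot (u *m G^T) z.
  rewrite dotC /dot trmx_mul mulmxA -[RHS]trace_mx11 -[LHS]trace_mx11.
  by rewrite -mulmxA.
ring.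
Qed.

(** The columns are not normalised: every entry is a phase, so their squared norm is the
    dimension. *)
Definition graph_code : 'M[C]_(pw d n, M) :=
  \matrix_(i, m) chi (qform (row_mx (iota m) (dec i))).

(* No nontrivial Pauli operator of weight at most [w] has a nonzero matrix
   element between code words: the code is nondegenerate. *)
Definition good_graph w := forall x (a b : 'rV[F]_n), (wt a b <= w)%N ->
  b = rsubmx (row_mx x a *m (G + G^T)) -> row_mx x a = 0 :> 'rV_(k + n).

(** Polarising [qform] makes each matrix element a phase times a character sum with frequency
    [b - rsubmx (u *m G2)]. It vanishes unless this frequency is zero, and then [good_graph] gives
    [u = 0]: equal code words and [a = 0], hence also [b = 0]. *)
Lemma graph_code_pauli w a b : good_graph w -> (wt a b <= w)%N ->
  adj graph_code *m pauli a b *m graph_code =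
  if (a == 0) && (b == 0) then (#|F| ^ n)%:R%:M else 0.
Proof.
move=> gG wab; apply/matrixP => m' m; rewrite mxE.
pose u := row_mx (iota m' - iota m) a : 'rV_(k + n).
pose G2 := G + G^T.
(* The part of the phase that does not depend on the summation vector [dec j]. *)
pose c := chi (- qform u - dot (lsubmx (u *m G2)) (iota m)).
have H j : (adj graph_code *m pauli a b) m' j * graph_code j m =
    c * chi (dot (b - rsubmx (u *m G2)) (dec j)).
  rewrite mxE.
  pose g s := chi (- qform (row_mx (iota m') s)) * chi (dot b (dec j)).
  rewrite (eq_bigr (fun s => if dec s == dec j + a then g (dec s) else 0)).
    rewrite sum_dec1 /g mxE /c -!chiD; congr chi.
    have -> : row_mx (iota m') (dec j + a) = row_mx (iota m) (dec j) + u.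
      by rewrite /u add_row_mx addrCA subrr addr0.
    rewrite qformD -/G2 dotDl dotNl.
    have -> : dot (u *m G2) (row_mx (iota m) (dec j)) =
        dot (lsubmx (u *m G2)) (iota m) + dot (rsubmx (u *m G2)) (dec j).
      by rewrite -dot_row hsubmxK.
    ring.
  move=> s _; rewrite adjE !mxE /g chiJ.
  by case: eqP => _ //; rewrite mulr0.
under eq_bigr do rewrite H.
rewrite -mulr_sumr (sum_dec (fun y => chi (dot (b - rsubmx (u *m G2)) y))) sum_chi.
rewrite subr_eq0; have [bE|bN] := eqVneq b (rsubmx (u *m G2)).
  have u0 := gG _ _ _ wab bE; rewrite -/u in u0.
  have a0 : a = 0.
    by have := congr1 rsubmx u0; rewrite row_mxKr => ->; apply/matrixP => i j; rewrite !mxE.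
  have b0 : b = 0 by rewrite bE u0 mul0mx; apply/matrixP => i j; rewrite !mxE.
  have mm : m' = m.
    apply: iota_inj; apply/eqP; rewrite -subr_eq0; apply/eqP.
    by have := congr1 lsubmx u0; rewrite row_mxKl => ->; apply/matrixP => i j; rewrite !mxE.
  rewrite a0 b0 !eqxx /= mxE mm eqxx mulr1n /c u0 mul0mx.
  have -> : lsubmx (0 : 'rV[F]_(k + n)) = 0 by apply/matrixP => i j; rewrite !mxE.
  by rewrite /qform mul0mx !dot0l subr0 oppr0 chi0 mul1r.
(* Here the character sum is zero. For [a = b = 0] this matches the off-diagonal entries; on the
   diagonal [u] would be zero, contradicting [bN]. *)
rewrite mulr0; case: ifP => [/andP[/eqP a0 /eqP b0]|_]; last by rewrite mxE.
have [mm|mm] := eqVneq m' m; last by rewrite mxE (negbTE mm).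
case/eqP: bN; rewrite b0 /u a0 mm subrr row_mx0 mul0mx.
by apply/matrixP => i j; rewrite !mxE.
Qed.

End GraphCode.
End Pauli.

(** Algebraic closedness supplies a root [om] of [1 + x + ... + x^(p-1)]. Then [om ^+ p = 1], and
    [om != 1] because the sum at 1 is [p]. Powers of [om] have modulus 1, so conjugation is
    inversion. *)
Lemma prime_character (R : realType) (p : nat) : prime p ->
  exists chi : 'F_p -> R[i], [/\ forall x y, chi (x + y) = chi x * chi y,
    chi 0 = 1, forall x, conjc (chi x) = chi (- x) & exists x, chi x != 1].
Proof.
move=> pp; have p1 := prime_gt1 pp; have p0 := prime_gt0 pp.
have [om hom] : exists x : R[i], x ^+ p.-1 = \sum_(i < p.-1) (-1) * x ^+ i.
  by apply: (@solve_monicpoly R[i] p.-1 (fun=> -1)); rewrite -ltnS prednK.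
have som : \sum_(i < p) om ^+ i = 0.
  rewrite -(prednK p0) big_ord_recr /= hom -mulr_sumr mulN1r subrr //.
have omp : om ^+ p = 1 by apply/eqP; rewrite -subr_eq0 subrX1 som mulr0.
have om1 : om != 1.
  apply/eqP => o1; move: som; rewrite o1.
  under eq_bigr do rewrite expr1n.
  by rewrite sumr_const card_ord => /eqP; rewrite pnatr_eq0 -leqn0 leqNgt p0.
have modp r : (r %% (Zp_trunc (pdiv p)).+2 = r %% p)%N by rewrite Fp_cast.
have [chi0 chiD] : om ^+ (0%R : 'F_p) = 1 /\
    forall x y : 'F_p, om ^+ (x + y : 'F_p)%R = om ^+ x * om ^+ y.
  split => // x y; rewrite /= modp -exprD.
  by rewrite [in RHS](divn_eq (x + y) p) exprD mulnC exprM omp expr1n mul1r.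
exists (fun x : 'F_p => om ^+ x); split => //.
- move=> x; have no : `|om ^+ x| = 1.
    apply/eqP; rewrite -(@pexpr_eq1 _ _ p) // -normrX -exprM mulnC exprM omp.
    by rewrite expr1n normr1.
  have nz : om ^+ x != 0 by rewrite -normr_eq0 no oner_eq0.
  apply: (mulfI nz); rewrite -chiD subrr chi0 -sqr_normc no expr1n //.
- by exists 1; rewrite /= modp modn_small.
Qed.

(** Chernoff-type bound: each counted pair contributes at least [t ^+ w] to the weight enumerator,
    which factorises over the sites; a site has one trivial pair and fewer than [#|F| ^ 2]
    others. *)
Lemma count_wt_le (R : realType) (F : finFieldType) n w (t : R) : 0 < t <= 1 ->
  #|[set p : 'rV[F]_n * 'rV[F]_n | (wt p.1 p.2 <= w)%N]|%:R * t ^+ w <=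
  (1 + (#|F| ^ 2)%:R * t) ^+ n.
Proof.
move=> /andP[t0 t1].
apply: (@le_trans _ _ (\sum_(p : 'rV[F]_n * 'rV[F]_n) t ^+ wt p.1 p.2)).
  rewrite (bigID (fun p : 'rV[F]_n * 'rV[F]_n => (wt p.1 p.2 <= w)%N)) /=.
  rewrite -[leLHS]addr0 lerD //; last by apply: sumr_ge0 => p _; rewrite exprn_ge0 // ltW.
  rewrite mulr_natl -sumr_const big_set.
  apply: ler_sum => p pw; apply: ler_wiXn2l => //; exact: ltW.
pose h (f : {ffun 'I_n -> F * F}) : 'rV[F]_n * 'rV[F]_n :=
  (\row_i (f i).1, \row_i (f i).2).
rewrite (reindex h); last first.
  apply: onW_bij.
  exists (fun p : 'rV[F]_n * 'rV[F]_n => [ffun i => (p.1 0 i, p.2 0 i)]) => [f|[a b]].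
    by apply/ffunP => i; rewrite ffunE !mxE -surjective_pairing.
  by congr (_, _); apply/matrixP => i j; rewrite mxE ffunE ord1.
have -> : \sum_f t ^+ wt (h f).1 (h f).2 =
    \sum_(f : {ffun 'I_n -> F * F}) \prod_i t ^+ (((f i).1 != 0%R) || ((f i).2 != 0%R)).
  apply: eq_bigr => f _; rewrite /wt expr_sum.
  by apply: eq_bigr => i _; rewrite !mxE.
rewrite -(bigA_distr_bigA (fun _ (j : F * F) => t ^+ ((j.1 != 0%R) || (j.2 != 0%R)))).
rewrite prodr_const card_ord lerXn2r ?nnegrE //.
- by apply: sumr_ge0 => j _; rewrite exprn_ge0 // ltW.
- by rewrite addr_ge0 // mulr_ge0 // ltW.
rewrite (bigD1 (0, 0)) //= eqxx /= expr0 lerD2l.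
apply: (@le_trans _ _ (\sum_(j : F * F) t)).
  rewrite [leRHS](bigD1 (0, 0)) //= -[leLHS]add0r lerD // ?(ltW t0) //.
  apply: ler_sum => -[x y] xy; move: xy; rewrite xpair_eqE negb_and /= => ->.
  by rewrite expr1.
by rewrite sumr_const card_prod mulr_natl expnS expn1.
Qed.

(** * Existence of good graphs by counting *)

Section GilbertVarshamov.
Variables (F : finFieldType) (k n : nat).
Local Notation q := #|F|.

(** The perturbations [E v] shift [n] of the [n.+1] output coordinates of [z (G + G^T)] by [z_i v].
    All bad [G] agree on these coordinates, so [G + E v] determines [v] and [G]. *)
Lemma card_bad_graphs (z : 'rV[F]_(k + n.+1)) (b : 'rV[F]_n.+1) : z != 0 ->
  (#|[set G : 'M[F]_(k + n.+1) | b == rsubmx (z *m (G + G^T))]| * q ^ n <=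
   #|{: 'M[F]_(k + n.+1)}|)%N.
Proof.
move=> z0; have [i zi] : exists i, z 0 i != 0.
  apply/existsP; apply: contraNT z0; rewrite negb_exists => /forallP h.
  apply/eqP/matrixP => a i; rewrite ord1 mxE; apply/eqP.
  by have := h i; rewrite negbK.
(* The output coordinate to be left out: [i] itself if it is an output, otherwise an arbitrary one.
   It accounts for the exponent [n] in place of [n.+1]. *)
pose i0 := if fintype.split i is inr i0 then i0 else ord0.
have i0P l : rshift k (lift i0 l) != i.
  rewrite /i0; case: split_ordP => j ->; rewrite ?eq_rlshift //.
  by rewrite eq_rshift eq_sym neq_lift.
pose u (v : 'rV[F]_n) : 'rV[F]_(k + n.+1) :=
  row_mx 0 (\row_j if unlift i0 j is Some l then v 0 l else 0).
(* Column [i] of [E v] is [u v]. Hence [z E v] lives only at coordinate [i], which is not among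
   those used, while [z (E v)^T = z_i u v]. *)
pose E v : 'M[F]_(k + n.+1) := (u v)^T *m delta_mx 0 i.
have zE v l : (z *m (E v + (E v)^T)) 0 (rshift k (lift i0 l)) = z 0 i * v 0 l.
  rewrite mulmxDr mxE [X in X + _](_ : _ = 0); last first.
    rewrite /E mulmxA mxE big1 // => j _.
    by rewrite [delta_mx _ _ _ _]mxE (negbTE (i0P l)) andbF mulr0.
  rewrite add0r /E trmx_mul trmxK trmx_delta mulmxA mxE big_ord1.
  rewrite -colE mxE; congr (_ * _).
  by rewrite /u row_mxEr mxE liftK.
set B := [set G | _].
have -> : (q ^ n)%N = #|[set: 'rV[F]_n]| by rewrite cardsT card_mx mul1n.
rewrite -cardsX -(@card_in_imset _ _ (fun p => p.1 + E p.2)) ?max_card //.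
move=> [G v] [G' v']; rewrite !inE !andbT /= => /eqP bG /eqP bG' eGG'.
have vv : v = v'.
  apply/matrixP => a l; rewrite ord1; apply: (mulfI zi); rewrite -!zE.
  have : (z *m (G + E v + (G + E v)^T)) 0 (rshift k (lift i0 l)) =
         (z *m (G' + E v' + (G' + E v')^T)) 0 (rshift k (lift i0 l)).
    by rewrite eGG'.
  have dist H w : z *m (H + E w + (H + E w)^T) =
      z *m (H + H^T) + z *m (E w + (E w)^T).
    by rewrite -mulmxDr; congr (_ *m _); rewrite [(H + E w)^T]raddfD addrACA.
  have bl (H : 'M[F]_(k + n.+1)) : b = rsubmx (z *m (H + H^T)) ->
      (z *m (H + H^T)) 0 (rshift k (lift i0 l)) = b 0 (lift i0 l).
    by move=> ->; rewrite [RHS]mxE.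
  by rewrite !dist [LHS]mxE [RHS]mxE (bl G bG) (bl G' bG') => /addrI.
by move: eGG'; rewrite vv => /addIr ->.
Qed.

(** Union bound: there are fewer than [q ^ n] triples [(x, (a, b))] to avoid, and each excludes at
    most the fraction [q ^ - n] of all matrices. *)
Lemma good_graph_exists w :
  (q ^ k * #|[set p : 'rV[F]_n.+1 * 'rV[F]_n.+1 | (wt p.1 p.2 <= w)%N]| < q ^ n)%N ->
  exists G : 'M[F]_(k + n.+1), good_graph G w.
Proof.
move=> small.
pose A := [set t : 'rV[F]_k * ('rV[F]_n.+1 * 'rV[F]_n.+1) |
  (wt t.2.1 t.2.2 <= w)%N && (row_mx t.1 t.2.1 != 0)].
pose bad (t : 'rV[F]_k * ('rV[F]_n.+1 * 'rV[F]_n.+1)) := [set G : 'M[F]_(k + n.+1) |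
  t.2.2 == rsubmx (row_mx t.1 t.2.1 *m (G + G^T))].
pose U := \bigcup_(t in A) bad t.
have cA : (#|A| < q ^ n)%N.
  apply: leq_ltn_trans small.
  rewrite -[(q ^ k)%N](_ : #|[set: 'rV[F]_k]| = _); last by rewrite cardsT card_mx mul1n.
  rewrite -cardsX; apply: subset_leq_card; apply/fintype.subsetP => -[x [a b]].
  by rewrite !inE /= => /andP[->].
have q0 : (0 < q ^ n)%N by apply: leq_ltn_trans cA.
have UT : (#|U| < #|{: 'M[F]_(k + n.+1)}|)%N.
  rewrite -(ltn_pmul2r q0); apply: (@leq_ltn_trans (#|A| * #|{: 'M[F]_(k + n.+1)}|)).
    apply: (@leq_trans ((\sum_(t in A) #|bad t|) * q ^ n)).
      rewrite leq_mul2r; apply/orP; right.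
      apply: (big_ind2 (fun (S : {set 'M[F]_(k + n.+1)}) m => #|S| <= m)%N) => //.
        by rewrite cards0.
      move=> S1 m1 S2 m2 h1 h2; apply: leq_trans (leq_add h1 h2).
      by have /leqifP := leq_card_setU S1 S2; case: ifP => [_ /eqP->|_ /ltnW].
    rewrite big_distrl /= -sum_nat_const; apply: leq_sum => t.
    by rewrite inE => /andP[_ tn0]; exact: card_bad_graphs.
  rewrite mulnC ltn_pmul2l //; apply/card_gt0P; by exists 0.
have [G GU] : exists G, G \notin U.
  apply/existsP; rewrite -negb_forall; apply: contraTN UT => /forallP h.
  rewrite -leqNgt -cardsT subset_leq_card //; apply/fintype.subsetP => G _; exact: h.
exists G => x a b wab bE; apply/eqP; apply: contraNT GU => xa0.
by apply/bigcupP; exists (x, (a, b)); rewrite !inE /= ?wab ?xa0 // -bE.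
Qed.

End GilbertVarshamov.

(** * Error bound at fixed block length *)

Section FiniteBlocklength.
Variables (R : realType) (d : nat) (T : 'M[R[i]]_d -> 'M[R[i]]_d) (delta : R).
Local Notation C := (R[i]).
Hypothesis d_prime : prime d.
Hypothesis T_channel : channel T.
Hypothesis delta_ge0 : 0 <= delta.
Let L X := T X - X.
Hypothesis L_cbb : cbb L delta.

Let L_linear : linear L.
Proof.
case: T_channel => lT _ c X Y; rewrite /L lT scalerBr opprD !addrA.
by congr (_ + _); rewrite addrAC.
Qed.

Let L1 : L 1%:M = 0.
Proof. by case: T_channel => _ [T1 _]; rewrite /L T1 subrr. Qed.

Lemma tpow_channel_wpart n A : tpow T A = \sum_(j < n.+1) wpart L (n := n) j A.
Proof.
rewrite -tpow_wpart //; congr (tpow _ A); apply/funext => X.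
by rewrite /L addrC subrK.
Qed.

(** The part of weight 0 cancels the subtracted identity and the parts of weight 1 to [f] vanish.
    The others obey [wpart_cbb], and composing with [E] and [D] does not increase the bound. *)
Lemma Delta_le_kspan n m (E : 'M[C]_(pw d n) -> 'M[C]_m) (D : 'M[C]_m -> 'M[C]_(pw d n))
    (f : nat) : channel E -> channel D -> cbb E 1 -> cbb D 1 ->
  (forall X, E (D X) = X) ->
  (forall j X, (0 < j <= f)%N -> E (wpart L j (D X)) = 0) ->
  (Delta (@tpow R d T n) m <=
    (\sum_(j < n.+1 | (f < j)%N) 'C(n, j)%:R * delta ^+ j)%:E)%E.
Proof.
move=> cE cD bE bD ED0 ED1; have lE := cE.1.
apply: (@le_trans _ _ (cbnorm (fun X => E (tpow T (D X)) - X))).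
  by apply: ereal_inf_lbound; exists E => //; exists D.
have b0 j : 0 <= 'C(n, j)%:R * delta ^+ j by rewrite mulr_ge0 // exprn_ge0.
apply: cbb_cbnorm_le; first by apply: sumr_ge0.
apply: (@eq_cbb _ _ _ (fun X => \sum_(j < n.+1 | (f < j)%N) E (wpart L j (D X)))).
  move=> X; rewrite tpow_channel_wpart linear_bigsum // [in RHS](bigD1 ord0) //=.
  rewrite [wpart L _ _ in RHS]wpart0 ED0 [X + _]addrC addrK.
  rewrite [RHS](bigID (fun j : 'I_n.+1 => (f < j)%N)) /= [X in _ = _ + X]big1.
    rewrite addr0; apply: eq_bigl => j; case: (ltnP f j) => fj; last by rewrite andbF.
    by rewrite andbT -(inj_eq val_inj) /= -lt0n (leq_ltn_trans _ fj).
  move=> j /andP[j0]; rewrite -leqNgt => jf; apply: ED1.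
  by rewrite jf andbT lt0n.
apply: cbb_sum => // j _.
have h1 := cbb_comp ler01 (@wpart_cbb _ _ L n j _ delta_ge0 L_cbb) bD.
by rewrite mulr1 in h1; have := cbb_comp (b0 j) bE h1; rewrite mul1r.
Qed.

(** Correcting weight [f] requires a good graph for weight [f.*2], since the orthogonality
    conditions involve products of two errors. *)
Lemma Delta_graph_code n k m f : (m < d ^ k)%N ->
  (d ^ k * #|[set p : 'rV['F_d]_n.+1 * 'rV['F_d]_n.+1 | (wt p.1 p.2 <= f.*2)%N]|
     < d ^ n)%N ->
  (Delta (@tpow R d T n.+1) m.+1 <=
    (\sum_(j < n.+2 | (f < j)%N) 'C(n.+1, j)%:R * delta ^+ j)%:E)%E.
Proof.
move=> mk small.
have [chi [chiD chi0 chiJ chi1]] := prime_character R d_prime.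
have cF : #|'F_d| = d by exact: card_Fp.
pose e (i : 'I_d) : 'F_d := enum_val (cast_ord (esym cF) i).
have e_bij : bijective e.
  exists (fun x => cast_ord cF (enum_rank x)) => x; rewrite /e.
    by rewrite enum_valK cast_ordKV.
  by rewrite cast_ordK enum_rankK.
have [G gG] : exists G : 'M['F_d]_(k + n.+1), good_graph G f.*2.
  by apply: good_graph_exists; rewrite cF.
have ck : (m < #|{: 'rV['F_d]_k}|)%N by rewrite card_mx mul1n cF.
pose iota (i : 'I_m.+1) : 'rV['F_d]_k := enum_val (widen_ord ck i).
have iota_inj : injective iota.
  by move=> i j /enum_val_inj /(congr1 val) /= h; exact: val_inj.
pose W := graph_code chi e G iota.
pose q : R := (d ^ n.+1)%:R.
have q0 : 0 < q by rewrite ltr0n expn_gt0 prime_gt0.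
(* Normalises the code words, whose squared norm is [d ^ n.+1], so that [V] is an isometry. *)
pose sc : C := ((Num.sqrt q)^-1)%:C%C.
have scq : conjc sc * sc * (d ^ n.+1)%:R = 1.
  rewrite /sc conjc_real -rmorphM /= -(rmorph_nat (real_complex R)) -rmorphM /=.
  rewrite -invfM -expr2 sqr_sqrtr ?ltW // mulVf ?gt_eqF //.
pose V := sc *: W.
pose P n' (a b : 'rV['F_d]_n') : 'M[C]_(pw d n') := pauli chi e a b.
have VPV a b : (wt a b <= f.*2)%N ->
    adj V *m P _ a b *m V = if (a == 0) && (b == 0) then 1%:M else 0.
  move=> wab; rewrite /V adj_scale -!scalemxAl -scalemxAr.
  rewrite (graph_code_pauli chiD chi0 chiJ chi1 e_bij iota_inj gG wab) cF scalerA.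
  case: ifP => _; last by rewrite scaler0.
  by rewrite scale_scalar_mx scq.
have V1 : adj V *m V = 1%:M.
  have := @VPV 0 0; rewrite wt0 /P pauli00 // mulmx1 !eqxx /=; exact.
clearbody V.
(* The recovery distinguishes all Pauli errors of weight at most [f]; these span the local operators
   in the parts of weight at most [f]. *)
pose J := {p : 'rV['F_d]_n.+1 * 'rV['F_d]_n.+1 | (wt p.1 p.2 <= f)%N}.
pose F (p : J) := P _ (val p).1 (val p).2.
have VFFV p p' : adj V *m adj (F p) *m (F p' *m V) = if p == p' then 1%:M else 0.
  rewrite mulmxA -[adj V *m _ *m _]mulmxA /F /P adj_pauli_mul // -scalemxAr -scalemxAl.
  rewrite VPV; last first.
    rewrite (leq_trans (wt_sub _ _ _ _)) // -addnn leq_add //.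
      exact: (valP p).
    exact: (valP p').
  rewrite !subr_eq0 -[X in if X then _ else _]/((_, _) == (_, _)) -!surjective_pairing.
  rewrite val_eqE eq_sym; case: eqP => [->|_]; last by rewrite scaler0.
  by rewrite subrr dotC dot0l oppr0 chi0 scale1r.
have spanF j K : (j <= f)%N -> locop j K -> lspan (fun K => exists p, K = F p) K.
  move=> jf hK; have := locop_span chiD chi0 chi1 e_bij hK.
  elim => [|c K1 K2 [a [b [wab ->]]] _ IH]; first exact: lspan0.
  apply: lspanD IH.
  by exists (exist _ (a, b) (leq_trans wab jf)).
have wcorr j : (j <= f)%N -> corrects V F (wpart L (n := n.+1) j).
  move=> jf; apply: (corrects_kspan VFFV _ (wpart_kspan L_linear n.+1 j)) => K.
  exact: spanF.
apply: (@Delta_le_kspan _ _ (encoder V) (decoder V F)).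
- exact: kraus_channel (encoder_kraus1 V1).
- exact: kraus_channel (decoder_kraus1 VFFV).
- exact: kraus_cbb (encoder_kraus1 V1).
- exact: kraus_cbb (decoder_kraus1 VFFV).
- move=> X; rewrite -[in LHS](wpart0 L (decoder V F X)).
  by apply: corrects_unit1 => //; [exact: wcorr|rewrite wpart0].
- move=> j X /andP[j0 jf]; apply: corrects_unit0; first exact: wcorr.
  exact: wpart_unit.
Qed.

(** For dimension 1 the decoder only produces multiples of the identity, which every part of
    positive weight kills. This serves the rate 0. *)
Lemma Delta_trivial n : (Delta (@tpow R d T n) 1 <= 0)%E.
Proof.
have pw0 : (0 < pw d n)%N.
  by elim: n => //= n IH; rewrite muln_gt0 prime_gt0.
pose i0 : 'I_(pw d n) := Ordinal pw0.
pose KE (u : unit) : 'M[C]_(1, pw d n) := delta_mx 0 i0.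
pose KD (l : 'I_(pw d n)) : 'M[C]_(pw d n, 1) := delta_mx l 0.
have KE1 : \sum_u KE u *m adj (KE u) = 1%:M.
  rewrite (big_pred1 tt); last by case.
  rewrite /KE adj_delta mul_delta_mx; apply/matrixP => i j.
  by rewrite !mxE !ord1 !eqxx.
have KD1 : \sum_l KD l *m adj (KD l) = 1%:M.
  under eq_bigr do rewrite /KD adj_delta mul_delta_mx.
  rewrite [RHS]matrix_sum_delta; apply: eq_bigr => i _.
  rewrite (bigD1 i) //= big1 ?addr0 => [|j /negbTE ij].
    by rewrite mxE eqxx scale1r.
  by rewrite mxE eq_sym ij scale0r.
have E_id X : kraus KE (wpart L 0 (kraus KD X)) = X.
  have -> : X = X 0 0 *: 1%:M by rewrite scalemx1 -mx11_scalar.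
  have [lD [D1 _]] := kraus_channel KD1; have [lE [E1 _]] := kraus_channel KE1.
  by rewrite wpart0 (linear_scalemx lD) D1 (linear_scalemx lE) E1.
(* With [f = n] the tail sum is empty. *)
have := @Delta_le_kspan n 1 (kraus KE) (kraus KD) n.
rewrite big_pred0 => [|j]; last by rewrite ltnNge -ltnS ltn_ord.
apply; try exact: kraus_channel; try exact: kraus_cbb.
  by move=> X; have := E_id X; rewrite wpart0.
move=> j X /andP[j0 _]; rewrite (mx11_scalar X) -scalemx1.
have [lD [D1 _]] := kraus_channel KD1; have [lE _] := kraus_channel KE1.
rewrite (linear_scalemx lD) D1 (linear_scalemx (wpart_linear L_linear j)).
by rewrite wpart_unit // scaler0 linear_0.
Qed.

End FiniteBlocklength.

(** * Asymptotics *)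

Section Asymptotics.
Variable R : realType.
Implicit Types eps p delta : R.

Lemma powR2E (x : R) : 2 `^ x = expR (x * ln 2).
Proof. by rewrite /powR pnatr_eq0. Qed.

Let ln2_gt0 : 0 < ln 2 :> R.
Proof. by rewrite ln_gt0 // ltr1n. Qed.

Lemma H2_ln2 p : H2 p * ln 2 = - p * ln p - (1 - p) * ln (1 - p).
Proof. by rewrite /H2 /log2; field; rewrite gt_eqF. Qed.

Lemma H2_ge0 p : 0 <= p <= 1 -> 0 <= H2 p.
Proof.
move=> /andP[p0 p1]; rewrite -(pmulr_lge0 _ ln2_gt0) H2_ln2.
have h1 : ln p <= 0 by exact: ln_le0.
have h2 : ln (1 - p) <= 0 by apply: ln_le0; lra.
nra.
Qed.

(** Since [mu <= 1], a factor [mu ^+ f.+1] can be pulled out of every term; by [key] the rest is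
    part of the binomial expansion of [(1 - eps + eps) ^+ n = 1]. *)
Lemma binomial_tail eps delta n f : 0 < eps < 1 -> 0 <= delta ->
  delta <= 2 `^ (- H2 eps / eps) -> eps * n%:R <= f.+1%:R ->
  \sum_(j < n.+1 | (f < j)%N) 'C(n, j)%:R * delta ^+ j <=
  (delta / 2 `^ (- H2 eps / eps)) ^+ f.+1.
Proof.
move=> /andP[e0 e1] d0 dle nf; set delta0 := 2 `^ _ in dle *.
have D0 : 0 < delta0 by rewrite powR_gt0.
pose mu := delta / delta0.
have mu0 : 0 <= mu by rewrite divr_ge0 // ltW.
have mu1 : mu <= 1 by rewrite ler_pdivrMr // mul1r.
have e1' : 0 < 1 - eps by rewrite subr_gt0.
have key j : (f < j <= n)%N -> delta0 ^+ j <= eps ^+ j * (1 - eps) ^+ (n - j).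
  move=> /andP[fj jn]; rewrite /delta0 powR2E -expRM_natl.
  rewrite -[X in X ^+ j * _](@lnK R) ?posrE // -expRM_natl.
  rewrite -[X in _ * X ^+ _](@lnK R) ?posrE // -expRM_natl -expRD ler_expR.
  have -> : - H2 eps / eps * ln 2 = ln eps + (1 - eps) / eps * ln (1 - eps).
    by rewrite mulrAC mulNr H2_ln2; field; rewrite gt_eqF.
  (* Because [ln (1 - eps) <= 0], the claim becomes [n - j <= j (1 - eps) / eps], that is,
     [eps n <= j]. *)
  rewrite mulrDr lerD2l mulrA ler_wnM2r //; first by apply: ln_le0; lra.
  rewrite natrB // mulrA ler_pdivlMr //.
  have : eps * n%:R <= j%:R by apply: (le_trans nf); rewrite ler_nat.
  nra.
apply: (@le_trans _ _ (mu ^+ f.+1 *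
  \sum_(j < n.+1 | (f < j)%N) 'C(n, j)%:R * (eps ^+ j * (1 - eps) ^+ (n - j)))).
  rewrite mulr_sumr; apply: ler_sum => j fj; rewrite mulrCA ler_wpM2l //.
  rewrite -[delta](@divfK _ delta0) ?gt_eqF // -/mu exprMn.
  apply: ler_pM; rewrite ?exprn_ge0 ?(ltW D0) //.
    by apply: ler_wiXn2l.
  by apply: key; rewrite fj -ltnS ltn_ord.
rewrite ler_piMr ?exprn_ge0 //.
apply: (@le_trans _ _ (\sum_(j < n.+1) 'C(n, j)%:R * (eps ^+ j * (1 - eps) ^+ (n - j)))).
  rewrite [leRHS](bigID (fun j : 'I_n.+1 => (f < j)%N)) /= lerDl.
  apply: sumr_ge0 => j _; rewrite mulr_ge0 // mulr_ge0 // exprn_ge0 // ltW //.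
rewrite (_ : \sum_(j < n.+1) _ = (1 - eps + eps) ^+ n); first by rewrite subrK expr1n.
by rewrite exprDn; apply: eq_bigr => j _; rewrite mulr_natl [_ ^+ j * _]mulrC.
Qed.

Lemma count_wt_entropy (F : finFieldType) n w p : 0 < p <= 1 / 2 -> w%:R <= p * n%:R ->
  #|[set x : 'rV[F]_n * 'rV[F]_n | (wt x.1 x.2 <= w)%N]|%:R <=
  expR (n%:R * (2 * p * ln #|F|%:R + H2 p * ln 2)).
Proof.
move=> /andP[p0 p2] wn; set q : R := #|F|%:R.
have q1 : 1 <= q by rewrite ler1n; apply/card_gt0P; exists 0.
have q0 : 0 < q by exact: lt_le_trans q1.
have p1 : 0 < 1 - p by lra.
(* The minimiser of [(1 + q^2 t)^n / t^(p n)]; the base becomes [1 / (1 - p)], and [p <= 1 / 2]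
   ensures [t <= 1]. *)
pose t := p / ((1 - p) * q ^+ 2).
have t0 : 0 < t by rewrite divr_gt0 // mulr_gt0 // exprn_gt0.
have t1 : t <= 1.
  rewrite ler_pdivrMr ?mul1r; last by rewrite mulr_gt0 // exprn_gt0.
  have : 1 <= q ^+ 2 by rewrite exprn_ege1.
  nra.
have := @count_wt_le R F n w t; rewrite t0 t1 => /(_ isT).
rewrite -ler_pdivlMr ?exprn_gt0 // => /le_trans; apply.
have -> : 1 + (#|F| ^ 2)%:R * t = (1 - p)^-1.
  by rewrite natrX -/q /t; field; rewrite -/q !gt_eqF.
have lnt : ln t = ln p - ln (1 - p) - 2 * ln q.
  rewrite /t ln_div ?posrE ?mulr_gt0 ?exprn_gt0 // lnM ?posrE ?exprn_gt0 //.
  by rewrite lnXn // -mulr_natl; ring.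
rewrite -[t](@lnK R) ?posrE // -expRM_natl -[(1 - p)^-1](@lnK R) ?posrE ?invr_gt0 //.
rewrite -expRM_natl -expRB ler_expR lnV ?posrE // H2_ln2 lnt.
have h : ln p - ln (1 - p) - 2 * ln q <= 0 by rewrite -lnt ln_le0.
have := ler_wnM2r h wn.
nra.
Qed.

(** The code dimension [m.+1] is rounded up to a power of [d]; the loss of a factor at most [d] does
    not affect the rate. *)
Lemma pow_between (d m : nat) : (1 < d)%N -> exists k, (m < d ^ k <= d * m.+1)%N.
Proof.
move=> d1; case: m => [|m]; first by exists 0%N; rewrite expn0 muln1 (ltnW d1).
exists (up_log d m.+2); have /andP[h1 ->] := up_log_bounds d1 (isT : (1 < m.+2)%N).
have k0 : (0 < up_log d m.+2)%N by rewrite up_log_gt0 d1.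
by rewrite -(prednK k0) expnS leq_mul2l ltnW ?orbT.
Qed.

(** Of the slack [2 * ln d%:R], one half pays for rounding the dimension up to [d ^ k], the other
    for [d ^ n] at block length [n.+1]. Counting is at relative weight [2 * eps], hence
    [eps <= 1 / 4]. *)
Lemma code_size_bound (d n k m f : nat) eps c : (1 < d)%N -> #|'F_d| = d ->
  0 < eps <= 1 / 4 -> 0 <= c ->
  (d ^ k <= d * m.+1)%N -> m.+1%:R <= 2 `^ (c * n.+1%:R) ->
  f%:R <= eps * n.+1%:R ->
  2 * ln d%:R < n.+1%:R * (((1 - 4 * eps) * log2 d%:R - H2 (2 * eps) - c) * ln 2) ->
  (d ^ k * #|[set p : 'rV['F_d]_n.+1 * 'rV['F_d]_n.+1 | (wt p.1 p.2 <= f.*2)%N]|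
     < d ^ n)%N.
Proof.
move=> d1 cF /andP[e0 e4] c0 kle mle fle big.
have dR0 : 0 < d%:R :> R by rewrite ltr0n ltnW.
have N := @count_wt_entropy 'F_d n.+1 f.*2 (2 * eps).
rewrite cF in N.
rewrite -(ltr_nat R) natrM natrX.
apply: (@le_lt_trans _ _ (expR (ln d%:R) * expR (c * n.+1%:R * ln 2) *
  expR (n.+1%:R * (2 * (2 * eps) * ln d%:R + H2 (2 * eps) * ln 2)))).
  apply: ler_pM => //.
    rewrite lnK ?posrE //; apply: (@le_trans _ _ (d%:R * m.+1%:R)).
      by rewrite -natrX -natrM ler_nat.
    by rewrite ler_pM2l // -powR2E.
  apply: N; first by apply/andP; split; lra.
  by rewrite -mul2n natrM -mulrA ler_pM2l.
rewrite natrX -[X in _ < X ^+ n](@lnK R) ?posrE // -expRM_natl -!expRD ltr_expR.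
move: big; rewrite -(natr1 n); set l := ln d%:R; set x := n%:R.
have -> : ((1 - 4 * eps) * log2 d%:R - H2 (2 * eps) - c) * ln 2 =
    (1 - 4 * eps) * l - H2 (2 * eps) * ln 2 - c * ln 2.
  by rewrite /log2 -/l; field; rewrite gt_eqF.
by set h := H2 (2 * eps); set z := ln 2; nra.
Qed.

End Asymptotics.

(** * Achievable rates *)

Section Achievability.
Variables (R : realType) (d : nat) (T : 'M[R[i]]_d -> 'M[R[i]]_d) (eps delta : R).
Hypothesis d_prime : prime d.
Hypothesis T_channel : channel T.
Hypothesis delta_ge0 : 0 <= delta.
Hypothesis L_cbb : cbb (fun X => T X - X) delta.

Lemma Delta_ge0 n m : (0 <= Delta (@tpow R d T n) m)%E.
Proof.
by apply: le_ereal_inf_tmp => _ [E _ [D _ <-]]; exact: cbnorm_ge0.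
Qed.

Lemma achievable0 : achievable T 0.
Proof.
split => //; apply: (@squeeze_cvge _ _ _ _ (cst 0%E) _ (cst 0%E)); try exact: cvg_cst.
near=> n; rewrite Delta_ge0 /= mul0r powRr0 truncn1.
exact: (Delta_trivial d_prime T_channel delta_ge0 L_cbb).
Unshelve. all: by end_near.
Qed.

Lemma achievable_lt c : 0 < eps < 1 / 2 -> delta < 2 `^ (- H2 eps / eps) ->
  0 <= c < (1 - 4 * eps) * log2 d%:R - H2 (2 * eps) -> achievable T c.
Proof.
move=> /andP[e0 e2] dlt /andP[c0 clt]; split => //.
have d1 := prime_gt1 d_prime.
have ln2 : 0 < ln 2 :> R by rewrite ln_gt0 // ltr1n.
have lnd : 0 < ln d%:R :> R by rewrite ln_gt0 // ltr1n.
(* Above 1/4 the bound on [c] would be negative, contradicting [0 <= c]. *)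
have e4 : eps <= 1 / 4.
  rewrite leNgt; apply/negP => e4.
  have H0 : 0 <= H2 (2 * eps) by apply: H2_ge0; apply/andP; split; lra.
  have : 0 < log2 d%:R :> R by rewrite divr_gt0.
  nra.
pose c1 := ((1 - 4 * eps) * log2 d%:R - H2 (2 * eps) - c) * ln 2.
have c1_gt0 : 0 < c1 by rewrite mulr_gt0 // subr_gt0.
pose mu := delta / 2 `^ (- H2 eps / eps).
have D0 : 0 < 2 `^ (- H2 eps / eps) by rewrite powR_gt0.
have mu0 : 0 <= mu by rewrite divr_ge0 // ltW.
have mu1 : mu < 1 by rewrite ltr_pdivrMr // mul1r.
pose f n := Num.truncn (eps * n%:R).
have bound n : 2 * ln d%:R / c1 < n.+1%:R ->
    (Delta (@tpow R d T n.+1) (Num.truncn (2 `^ (c * n.+1%:R))) <=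
     (mu ^+ (f n.+1).+1)%:E)%E.
  rewrite ltr_pdivrMr // => big.
  (* As [c >= 0], the dimension is at least 1 and can be written [m.+1]. *)
  have M0 : (0 < Num.truncn (2 `^ (c * n.+1%:R) : R))%N.
    by rewrite truncn_gt0 powR2E -[leLHS]expR0 ler_expR !mulr_ge0 // ltW.
  have Mle : (Num.truncn (2 `^ (c * n.+1%:R) : R))%:R <= 2 `^ (c * n.+1%:R) :> R.
    by rewrite truncn_le powR_ge0.
  case: (Num.truncn _) M0 Mle => // m _ Mle.
  have [k /andP[mk kd]] := pow_between m d1.
  have fle : (f n.+1)%:R <= eps * n.+1%:R by rewrite truncn_le mulr_ge0 // ltW.
  have small : (d ^ k * #|[set p : 'rV['F_d]_n.+1 * 'rV['F_d]_n.+1 |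
      (wt p.1 p.2 <= (f n.+1).*2)%N]| < d ^ n)%N.
    apply: (@code_size_bound R d n k m (f n.+1) eps c) => //.
    + exact: card_Fp.
    + by rewrite e0.
  apply: (le_trans (Delta_graph_code d_prime T_channel delta_ge0 L_cbb mk small)).
  rewrite lee_fin; apply: binomial_tail => //.
  + by rewrite e0 /=; lra.
  + exact: ltW.
  + by apply: ltW; exact: truncnS_gt.
apply: (@squeeze_cvge _ _ _ _ (cst 0%E) _ (fun n => (mu ^+ (f n).+1)%:E)).
- near=> n; rewrite Delta_ge0 /=.
  have n0 : (0 < n)%N by near: n; exact: nbhs_infty_gt.
  rewrite -(prednK n0); apply: bound; rewrite prednK //.
  by near: n; exact: nbhs_infty_gtr.
- exact: cvg_cst.
- apply: cvg_EFin; first by near=> n.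
  (* The number of corrected errors grows linearly, so the powers of [mu < 1] tend to 0. *)
  have fy : ((fun n => (f n).+1) @ \oo --> \oo)%classic.
    apply/cvgnyPge => A; near=> n; rewrite /f ltnW // ltnS truncn_ge_nat; last first.
      by rewrite mulr_ge0 // ltW.
    rewrite mulrC -ler_pdivrMr //; near: n; exact: nbhs_infty_ger.
  apply: (cvg_comp _ _ fy); apply: cvg_expr; by rewrite ger0_norm.
Unshelve. all: by end_near.
Qed.

End Achievability.

Theorem theorem1 (R : realType) (d : nat) (T : 'M[R[i]]_d -> 'M[R[i]]_d)
  (eps : R) :
  prime d -> channel T -> 0 < eps < 1 / 2 ->
  (cbnorm (fun X => (X - T X)%R) < (2 `^ (- H2 eps / eps))%:E)%E ->
  (((1 - 4 * eps) * log2 d%:R - H2 (2 * eps))%:E <= Qcap T)%E.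
Proof.
move=> d_prime cT heps hcb; set c0 := (_ - _ : R).
(* The cb-norm is finite by hypothesis; its real value bounds [id - T], and after a change of sign
   [T - id]. *)
have [delta [delta0 delta_lt L_cbb]] : exists delta : R,
    [/\ 0 <= delta, delta < 2 `^ (- H2 eps / eps) & cbb (fun X => T X - X) delta].
  have y0 := cbnorm_ge0 (fun X => X - T X).
  have yf : cbnorm (fun X => X - T X) \is a fin_num.
    by rewrite ge0_fin_numE // (lt_trans hcb) // ltry.
  exists (fine (cbnorm (fun X => X - T X))); split.
  - exact: fine_ge0.
  - by rewrite -lte_fin fineK.
  apply: (@eq_cbb _ _ _ (fun X => - (X - T X))); first by move=> X; rewrite opprB.
  apply: cbbN; apply: cbnorm_le_cbb; rewrite ?fine_ge0 ?fineK //.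
  case: cT => lT _ c X Y; rewrite lT scalerBr opprD !addrA.
  by congr (_ + _); rewrite addrAC.
(* The achievable rate 0 gives the lower bound needed to make [Qcap T] finite in the contradiction
   below and to place the midpoint rate at or above 0. *)
have Q0 : (0 <= Qcap T)%E.
  apply: ereal_sup_ubound; exists 0 => //=.
  exact: (achievable0 d_prime cT delta0 L_cbb).
have Qlt c : 0 <= c < c0 -> (c%:E <= Qcap T)%E.
  move=> hc; apply: ereal_sup_ubound; exists c => //=.
  exact: (achievable_lt d_prime cT delta0 L_cbb heps delta_lt hc).
(* If the capacity were below [c0], it would be a real number, and the midpoint between it and [c0]
   would be an achievable rate exceeding it. *)
rewrite leNgt; apply/negP => Qc0.
have Qf : (Qcap T \is a fin_num)%E by rewrite ge0_fin_numE // (lt_trans Qc0) // ltry.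
move: Q0 Qlt Qc0; rewrite -(fineK Qf); set r := fine _.
rewrite !lee_fin lte_fin => r0 Qlt rc0.
have := Qlt ((r + c0) / 2); rewrite lee_fin => /(_ _).
have -> : 0 <= (r + c0) / 2 < c0 by apply/andP; split; lra.
by move=> /(_ isT); lra.
Qed.
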